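(* Let $E$ be a countable set, let $r:E\times E\to\mathbb{R}$ (negative values allowed) satisfy $r(x,x)=0$ for all $x\in E$ and $\sup_{x\in E}\sum_{y\in E}|r(x,y)|<\infty$, and let $V:E\to\mathbb{R}$ satisfy $\sup_{x\in E}|V(x)|<\infty$. For bounded $f:E\to\mathbb{R}$ define $$Af(x)=\sum_{y\in E}r(x,y)\,[f(y)-f(x)]+V(x)f(x),\qquad x\in E.$$ Then $A$ is a bounded operator with respect to the supremum norm (on the space of bounded functions $E\to\mathbb{R}$), $S_t=e^{tA}$ is well-defined for all $t\ge 0$, and for every bounded $f:E\to\mathbb{R}$, every $x\in E$ and every $t\ge 0$, $$S_tf(x)=\mathbb{E}_{x,+1}\left[Z_t\, f(\widehat{X}_t)\,\exp\left(\int_0^t\Big(2\sum_{y\in E}r^-(\widehat{X}_u,y)+V(\widehat{X}_u)\Big)\,du\right)\right],$$ where $r^-(x,y)=\max(-r(x,y),0)$ and $(\widehat{X}_t,Z_t)_{t\ge0}$ is the Markov jump process on $E\times\{-1,+1\}$ defined in the context, started at $(x,+1)$ under $\mathbb{P}_{x,+1}$.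
   Context: Write $r^+(x,y)=\max(r(x,y),0)$ and $r^-(x,y)=\max(-r(x,y),0)$. The process $(\widehat{X}_t,Z_t)_{t\ge0}$ is the continuous-time Markov jump process on $E\times\{-1,+1\}$ with generator $$\widehat{L}f(x,s)=\sum_{y\in E}r^+(x,y)\,[f(y,s)-f(x,s)]+\sum_{y\in E}r^-(x,y)\,[f(y,-s)-f(x,s)],$$ i.e. from state $(x,s)$ it jumps to $(y,s)$ at rate $r^+(x,y)$ and to $(y,-s)$ at rate $r^-(x,y)$. $\mathbb{E}_{x,s}$ denotes expectation for this process started at $(x,s)$. *)

(* Defs.v *)
From HB Require Import structures.
From mathcomp Require Export all_boot all_order all_algebra.
From mathcomp Require Export all_classical all_reals all_analysis.

Set Implicit Arguments.
Unset Strict Implicit.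
Unset Printing Implicit Defensive.

Export Order.TTheory GRing.Theory Num.Theory numFieldNormedType.Exports.

#[global] Open Scope classical_set_scope.
#[global] Open Scope ring_scope.

(* Unconditional sum of an absolutely summable real family, as the difference
   of the sums of its positive and negative parts; the value is meaningless
   when the family is not absolutely summable. *)
Definition csum (R : realType) (I : choiceType) (u : I -> R) : R :=
  fine (\esum_(i in [set: I]) (u^\+ i)%:E)
  - fine (\esum_(i in [set: I]) (u^\- i)%:E).

Definition supnorm (R : realType) (T : Type) (f : T -> R) : R :=
  sup (range (fun x => `|f x|)).

(* Operators are functions on all of [T -> R]; only their restriction to the
   bounded functions matters. *)
Record bounded_operator (R : realType) (T : Type)
    (B : (T -> R) -> (T -> R)) : Prop := BoundedOperator {
  bop_linear : forall (a : R) (f g : T -> R), bounded_fun f -> bounded_fun g ->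
    forall x, B (fun y => a * f y + g y) x = a * B f x + B g x ;
  bop_stable : forall f : T -> R, bounded_fun f -> bounded_fun (B f) ;
  bop_bounded : exists C : R, forall f : T -> R, bounded_fun f ->
    supnorm (B f) <= C * supnorm f }.

Definition opnorm (R : realType) (T : Type) (B : (T -> R) -> (T -> R)) : R :=
  sup [set supnorm (B f) | f in [set f : T -> R | bounded_fun f /\ supnorm f <= 1]].

Definition expop_partial (R : realType) (T : Type) (B : (T -> R) -> (T -> R))
    (n : nat) (f : T -> R) (x : T) : R :=
  \sum_(0 <= k < n) (k`!%:R)^-1 * iter k B f x.

Definition expop (R : realType) (T : Type) (B : (T -> R) -> (T -> R))
    (f : T -> R) (x : T) : R :=
  limn (fun n => expop_partial B n f x).

(* [opnorm] is a true operator norm only on bounded operators, whence the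
   first two conjuncts. *)
Definition expop_well_defined (R : realType) (T : Type)
    (B : (T -> R) -> (T -> R)) : Prop :=
  [/\ forall n, bounded_operator (expop_partial B n),
      bounded_operator (expop B) &
      opnorm (fun f x => expop_partial B n f x - expop B f x) @[n --> \oo] --> (0 : R)].

Section JumpProcess.
Variables (R : realType) (S : countType).

Record transition_function (p : R -> S -> S -> R) : Prop := TransitionFunction {
  tf_ge0 : forall (t : R) a b, 0 <= t -> 0 <= p t a b ;
  tf_sum1 : forall (t : R) a, 0 <= t -> (\esum_(b in [set: S]) (p t a b)%:E = 1)%E ;
  tf_0 : forall a b, p 0 a b = (a == b)%:R ;
  tf_CK : forall (s t : R) a b, 0 <= s -> 0 <= t ->
    p (s + t) a b = csum (fun c => p s a c * p t c b) }.

Definition tf_op (p : R -> S -> S -> R) (t : R) (g : S -> R) (a : S) : R :=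
  csum (fun b => p t a b * g b).

(* The domain of the generator is the whole space of bounded functions, as is
   the case for bounded jump rates. *)
Definition has_generator (p : R -> S -> S -> R) (L : (S -> R) -> (S -> R)) : Prop :=
  forall g : S -> R, bounded_fun g ->
    {uniform, (fun (h : R) (a : S) => h^-1 * (tf_op p h g a - g a)) @ 0^'+ --> L g}.

Definition cadlag_discrete (c : R -> S) : Prop :=
  (forall t : R, 0 <= t -> \forall s \near t^'+, c s = c t) /\
  (forall t : R, 0 < t -> exists a : S, \forall s \near t^'-, c s = a).

Definition visits (T : Type) (Y : R -> T -> S) (h : seq (R * S)) : set T :=
  [set w | forall q, q \in h -> Y q.1 w = q.2].

(* Elementary Markov property: the conditioning events [visits Y h] with times
   in [0, u] generate the past of [u]. *)
Record jump_process (L : (S -> R) -> (S -> R)) (a0 : S) (d : measure_display)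
    (T : measurableType d) (P : probability T R) (Y : R -> T -> S) : Prop :=
  JumpProcess {
  jp_measurable : forall t : R, 0 <= t -> forall B : set S, measurable (Y t @^-1` B) ;
  jp_cadlag : forall w, cadlag_discrete (fun t => Y t w) ;
  jp_start : P [set w | Y 0 w = a0] = 1%E ;
  jp_markov : exists p : R -> S -> S -> R,
    [/\ transition_function p, has_generator p L &
        forall (h : seq (R * S)) (u t : R) (a b : S),
          (forall q : R * S, q \in h -> 0 <= q.1 <= u) -> 0 <= u -> 0 <= t ->
          (P (visits Y h `&` [set w | Y u w = a] `&` [set w | Y (u + t)%R w = b])
           = P (visits Y h `&` [set w | Y u w = a]) * (p t a b)%:E)%E] }.

End JumpProcess.

Section SignedRates.
Variables (R : realType) (E : countType) (r : E -> E -> R) (V : E -> R).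

Definition rplus (x y : E) : R := Num.max (r x y) 0.
Definition rminus (x y : E) : R := Num.max (- r x y) 0.

Definition signedA (f : E -> R) (x : E) : R :=
  csum (fun y => r x y * (f y - f x)) + V x * f x.

Definition semigroupS (t : R) : (E -> R) -> (E -> R) :=
  expop (fun f x => t * signedA f x).

(* The sign component is a boolean [s] standing for [(-1) ^+ s], so [false]
   is +1, [true] is -1 and [~~ s] is the opposite sign. *)
Definition Lhat (g : E * bool -> R) (a : E * bool) : R :=
  csum (fun y => rplus a.1 y * (g (y, a.2) - g a))
  + csum (fun y => rminus a.1 y * (g (y, ~~ a.2) - g a)).

Definition Zsign (T : Type) (Y : R -> T -> E * bool) (t : R) (w : T) : R :=
  (-1) ^+ (Y t w).2.

Definition FKweight (T : Type) (Y : R -> T -> E * bool) (t : R) (w : T) : R :=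
  expR (\int[lebesgue_measure]_(u in `[0, t])
          (2 * csum (fun y => rminus (Y u w).1 y) + V (Y u w).1)).

End SignedRates.

(* Main.v *)
(* Lift [f] to the signed function [(x, s) |-> s * f x] on [E * {-1, +1}].
   The generator of the jump process plus the potential
   [2 * sum_y r^-(x, y) + V x] acts on signed functions as [A] acts on [f].
   The expectation is then computed by time discretization with step
   [h = t / n].  By the Markov property, replacing the time integral by its
   right Riemann sum turns the expectation into the n-th power of
   [g |-> P_h (e^{hW} g)].  The generator and semigroup properties give
   [|P_h g - g - h L g| <= h^2 |L^2 g|], so this step differs from [1 + h (L + W)]
   by O(h^2), and on signed functions the powers of the latter are those of
   [1 + (t/n) A], which converge to [e^{tA}].  On the probabilistic side the
   right Riemann sums converge because the paths are right-continuous, and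
   dominated convergence concludes. *)
Require Import Defs.
From mathcomp Require Import ring lra measurable_realfun.
Set Implicit Arguments.
Unset Strict Implicit.
Unset Printing Implicit Defensive.

(** * Absolutely summable families *)

Section Csum.
Variables (R : realType) (I : choiceType).
Implicit Types u v a b : I -> R.

(** The bound [B] is kept explicit and need not be the sum: it provides at once the finiteness
    required by [csum] and the estimates used later. *)
Definition absum (B : R) u := (\esum_(i in [set: I]) `|u i|%:E <= B%:E)%E.

(** Bounding finite subsums gives one inequality, [le_scale]. For [k > 0] the other one is
    [le_scale] again, applied to [k^-1] and the scaled family. *)
Lemma ge0_esumZ (k : R) (a : I -> \bar R) : 0 <= k -> (forall i, 0 <= a i)%E ->
  (\esum_(i in [set: I]) (k%:E * a i) = k%:E * \esum_(i in [set: I]) a i)%E.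
Proof.
move=> k0 a0.
have le_scale (c : R) (b : I -> \bar R) : 0 <= c -> (forall i, 0 <= b i)%E ->
    (\esum_(i in [set: I]) (c%:E * b i) <= c%:E * \esum_(i in [set: I]) b i)%E.
  move=> c0 b0; apply: ge_ereal_sup => _ [X [finX _] <-].
  rewrite -ge0_mule_fsumr//; apply: lee_wpmul2l; first by rewrite lee_fin.
  by apply: ereal_sup_ubound; exists X.
apply/eqP; rewrite eq_le le_scale//=.
have [->|kn0] := eqVneq k 0.
  by rewrite mul0e esum_ge0// => i _; rewrite mul0e.
have {}k0 : 0 < k by rewrite lt_neqAle eq_sym kn0.
rewrite -lee_pdivlMl// (le_trans _ (le_scale _ _ _ _))//.
- by apply: le_esum => i _; rewrite muleA -EFinM mulVf ?mul1e// gt_eqF.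
- by rewrite invr_ge0 ltW.
- by move=> i; rewrite mule_ge0// lee_fin ltW.
Qed.

Lemma absum_le B u v : (forall i, `|v i| <= `|u i|) -> absum B u -> absum B v.
Proof.
by move=> vu uB; rewrite /absum (le_trans _ uB)//; apply: le_esum => i _; rewrite lee_fin.
Qed.

Lemma absumZ B (k : R) u : absum B u -> absum (`|k| * B) (fun i => k * u i).
Proof.
move=> uB; rewrite /absum.
under eq_esum do rewrite normrM EFinM.
rewrite ge0_esumZ//.
by rewrite EFinM lee_wpmul2l// lee_fin.
Qed.

Lemma absumD B C u v : absum B u -> absum C v -> absum (B + C) (fun i => u i + v i).
Proof.
move=> uB vC; rewrite /absum EFinD.
rewrite (le_trans _ (leeD uB vC))// -esumD; [|by move=> *; rewrite lee_fin..].
by apply: le_esum => i _; rewrite -EFinD lee_fin ler_normD.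
Qed.

Lemma absumM B (G : R) u v : absum B u -> 0 <= G -> (forall i, `|v i| <= G) ->
  absum (B * G) (fun i => u i * v i).
Proof.
move=> uB G0 vG; rewrite -[G]ger0_norm// mulrC.
apply: absum_le (absumZ G uB) => i.
by rewrite !normrM mulrC ler_wpM2r// (ger0_norm G0).
Qed.

(** The decomposition into nonnegative families is irrelevant: termwise [u^+ + b = u^- + a], and
    since all four sums are finite the summed identity can be rearranged. Linearity of [csum] rests
    on this. *)
Lemma csum_split u a b A B : (forall i, 0 <= a i) -> (forall i, 0 <= b i) ->
  absum A a -> absum B b -> (forall i, u i = a i - b i) ->
  csum u = fine (\esum_(i in [set: I]) (a i)%:E) - fine (\esum_(i in [set: I]) (b i)%:E).
Proof.
move=> a0 b0 aA bB uab.
have up i : u^\+ i <= a i.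
  by rewrite /funrpos ge_max a0 uab andbT lerBlDr lerDl.
have un i : u^\- i <= b i.
  by rewrite /funrneg ge_max b0 uab andbT opprB lerBlDr lerDl.
have finE A' (c c' : I -> R) : (forall i, 0 <= c' i) -> (forall i, c' i <= c i) ->
    absum A' c -> (\esum_(i in [set: I]) (c' i)%:E \is a fin_num)%E.
  move=> c0 cc cA; rewrite ge0_fin_numE; last by apply: esum_ge0 => i _; rewrite lee_fin.
  apply: le_lt_trans (ltry A'); apply: le_trans cA.
  apply: le_esum => i _; rewrite lee_fin (le_trans (cc i))//; exact: ler_norm.
have e : (\esum_(i in [set: I]) (u^\+ i)%:E + \esum_(i in [set: I]) (b i)%:E =
      \esum_(i in [set: I]) (u^\- i)%:E + \esum_(i in [set: I]) (a i)%:E)%E.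
  rewrite -!esumD; try by move=> i _; rewrite lee_fin// ?funrpos_ge0 ?funrneg_ge0.
  apply: eq_esum => i _; rewrite -!EFinD; congr EFin.
  have := congr1 (fun f => f i) (funrposBneg u); rewrite !fctE uab.
  lra.
rewrite /csum; move/(congr1 (@fine R)): e; rewrite !fineD; first lra.
all: apply: finE; [|move=> ?; first [exact: up|exact: un|exact: lexx]|eassumption] => // i.
all: by rewrite ?funrpos_ge0 ?funrneg_ge0.
Qed.

Lemma csum_EFin u B : (forall i, 0 <= u i) -> absum B u ->
  ((csum u)%:E = \esum_(i in [set: I]) (u i)%:E)%E.
Proof.
move=> u0 uB; rewrite (@csum_split u u (cst 0) B 0)//.
- rewrite [X in _ - fine X](_ : _ = 0%E) ?subr0; last exact: esum1.
  rewrite fineK// ge0_fin_numE; last by apply: esum_ge0 => *; rewrite lee_fin.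
  apply: le_lt_trans (ltry B); apply: le_trans uB.
  by apply: le_esum => i _; rewrite lee_fin ler_norm.
- by rewrite /absum esum1// => i _; rewrite normr0.
- by move=> i; rewrite subr0.
Qed.

Lemma csum_posneg u B : absum B u -> [/\ absum B (u^\+), absum B (u^\-) &
  csum u = csum (u^\+) - csum (u^\-)].
Proof.
move=> uB.
have pB : absum B (u^\+).
  apply: absum_le uB => i; rewrite ger0_norm ?funrpos_ge0// ge_max normr_ge0.
  by rewrite ler_norm.
have nB : absum B (u^\-).
  apply: absum_le uB => i; rewrite ger0_norm ?funrneg_ge0// ge_max normr_ge0.
  by rewrite -normrN ler_norm.
split=> //; rewrite (csum_split _ _ pB nB) ?funrpos_ge0 ?funrneg_ge0//.
- by rewrite -!(csum_EFin _ pB) -?(csum_EFin _ nB) ?fine_EFin// => i;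
    rewrite ?funrpos_ge0 ?funrneg_ge0.
by move=> i; rewrite -[u in LHS]funrposBneg.
Qed.

Lemma ge0_csum_comb (a b : R) u v B C : 0 <= a -> 0 <= b ->
  (forall i, 0 <= u i) -> (forall i, 0 <= v i) -> absum B u -> absum C v ->
  csum (fun i => a * u i + b * v i) = a * csum u + b * csum v.
Proof.
move=> a0 b0 u0 v0 uB vC; apply: EFin_inj.
rewrite (csum_EFin _ (absumD (absumZ a uB) (absumZ b vC))); last first.
  by move=> i; rewrite addr_ge0// mulr_ge0.
rewrite EFinD !EFinM (csum_EFin u0 uB) (csum_EFin v0 vC) -!ge0_esumZ//;
  [|by move=> i; rewrite lee_fin..].
rewrite -esumD//; try by move=> i _; rewrite -EFinM lee_fin mulr_ge0.
Qed.

Lemma csum_ge0 u B : (forall i, 0 <= u i) -> absum B u -> 0 <= csum u <= B.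
Proof.
move=> u0 uB; rewrite -!lee_fin (csum_EFin u0 uB).
rewrite esum_ge0//=; last by move=> i _; rewrite lee_fin.
by apply: le_trans uB; apply: le_esum => i _; rewrite lee_fin ler_norm.
Qed.

Lemma csumB u a b A B : (forall i, 0 <= a i) -> (forall i, 0 <= b i) ->
  absum A a -> absum B b -> (forall i, u i = a i - b i) ->
  csum u = csum a - csum b.
Proof.
move=> a0 b0 aA bB uab; rewrite (csum_split a0 b0 aA bB uab).
by rewrite -(csum_EFin a0 aA) -(csum_EFin b0 bB).
Qed.

(** For [k >= 0] the combination splits as [(k u^+ + v^+) - (k u^- + v^-)]; for [k < 0] the parts of
    [u] trade places with the factor [- k]. *)
Lemma csum_linear (k : R) u v B C : absum B u -> absum C v ->
  csum (fun i => k * u i + v i) = k * csum u + csum v.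
Proof.
move=> uB vC; have [upB unB ->] := csum_posneg uB.
have [vpC vnC ->] := csum_posneg vC.
have [k0|/ltW k0] := leP 0 k.
- have pB := absumD (absumZ k upB) (absumZ 1 vpC).
  have nB := absumD (absumZ k unB) (absumZ 1 vnC).
  rewrite (csumB _ _ pB nB).
  + rewrite !(@ge0_csum_comb _ _ _ _ B C)//; try (move=> i; rewrite ?funrpos_ge0 ?funrneg_ge0//).
    lra.
  + by move=> i; rewrite mul1r addr_ge0// ?mulr_ge0// funrpos_ge0.
  + by move=> i; rewrite mul1r addr_ge0// ?mulr_ge0// funrneg_ge0.
  + move=> i; rewrite -[u in LHS]funrposBneg -[v in LHS]funrposBneg !fctE; lra.
- have nk : 0 <= - k by rewrite oppr_ge0.
  have pB := absumD (absumZ (- k) unB) (absumZ 1 vpC).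
  have nB := absumD (absumZ (- k) upB) (absumZ 1 vnC).
  rewrite (csumB _ _ pB nB).
  + rewrite !(@ge0_csum_comb _ _ _ _ B C)//; try (move=> i; rewrite ?funrpos_ge0 ?funrneg_ge0//).
    lra.
  + by move=> i; rewrite mul1r addr_ge0// ?mulr_ge0// ?funrpos_ge0// funrneg_ge0.
  + by move=> i; rewrite mul1r addr_ge0// ?mulr_ge0// ?funrpos_ge0// funrneg_ge0.
  + move=> i; rewrite -[u in LHS]funrposBneg -[v in LHS]funrposBneg !fctE; lra.
Qed.

Lemma csum_norm u B : absum B u -> `|csum u| <= B.
Proof.
move=> uB; have [pB nB ->] := csum_posneg uB.
have p0 i : 0 <= u^\+ i by rewrite funrpos_ge0.
have n0 i : 0 <= u^\- i by rewrite funrneg_ge0.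
have := csum_ge0 p0 pB; have := csum_ge0 n0 nB.
rewrite ler_norml; lra.
Qed.

Lemma csumZ (k : R) u B : absum B u -> csum (fun i => k * u i) = k * csum u.
Proof.
move=> uB; have z0 : absum 0 (fun _ : I => 0 : R) by rewrite /absum esum1// => i _; rewrite normr0.
have /eqP c0 : csum (fun _ : I => 0 : R) == 0 by rewrite -normr_le0 csum_norm.
rewrite -[RHS]addr0 -c0 -(csum_linear k uB z0); congr csum.
by apply/funext => i; rewrite addr0.
Qed.
End Csum.

(** * Exponentials of bounded operators *)

Section Operators.
Variables (R : realType) (T : Type).
Implicit Types (f g : T -> R) (B : (T -> R) -> (T -> R)) (C M : R).

(** The constant is explicit so that errors can be tracked. It can be negative when [T] is empty, so
    [0 <= C] is derived from a point wherever it is needed. *)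
Definition bdd C f := forall x, `|f x| <= C.

Lemma bdd_bounded_on C f (A : set T) : bdd C f -> [bounded f x | x in A].
Proof.
move=> fC; exists C; split; first exact: num_real.
by move=> y Cy x _; exact: le_trans (fC x) (ltW Cy).
Qed.

Lemma bdd_bounded C f : bdd C f -> bounded_fun f.
Proof. exact: bdd_bounded_on. Qed.

Lemma bounded_bdd f : bounded_fun f -> exists2 C, 0 <= C & bdd C f.
Proof.
move=> [C [_ fC]]; exists (`|C| + 1); first by rewrite addr_ge0.
by move=> x; apply: fC => //; rewrite (le_lt_trans (ler_norm C))// ltrDl.
Qed.

Lemma bdd_comb (k : R) f g C D : bdd C f -> bdd D g ->
  bdd (`|k| * C + D) (fun x => k * f x + g x).
Proof.
move=> fC gD x; rewrite (le_trans (ler_normD _ _))// lerD//.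
by rewrite normrM ler_wpM2l.
Qed.

Lemma le_bdd C D f : bdd C f -> C <= D -> bdd D f.
Proof. by move=> fC CD x; exact: le_trans (fC x) CD. Qed.

Lemma supnorm_le C f : 0 <= C -> bdd C f -> 0 <= supnorm f <= C.
Proof.
(* On an empty [T] the supremum is [sup set0 = 0]. *)
move=> C0 fC; rewrite /supnorm; have [->|/set0P[y Ey]] := eqVneq (range (fun x => `|f x|)) set0.
  by rewrite sup0 lexx.
apply/andP; split.
  case: Ey => x _ _; rewrite (le_trans (normr_ge0 (f x)))//.
  by apply: ub_le_sup; [exists C => _ [z _ <-]; exact: fC|exists x].
by apply: ge_sup; [exists y|move=> _ [z _ <-]; exact: fC].
Qed.

Lemma bdd_supnorm f : bounded_fun f -> bdd (supnorm f) f.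
Proof.
move=> /bounded_bdd[C C0 fC] x; apply: ub_le_sup; last by exists x.
by exists C => _ [z _ <-]; exact: fC.
Qed.

(** Quantitative counterpart of [bounded_operator]: [M] is an upper bound of the operator norm,
    stable under composition and combination, which avoids handling [supnorm] and [opnorm] in
    estimates. *)
Record opb M B : Prop := Opb {
  opb_ge0 : 0 <= M ;
  opb_lin : forall (k : R) f g, bounded_fun f -> bounded_fun g ->
    B (fun x => k * f x + g x) = (fun x => k * B f x + B g x) ;
  opb_bdd : forall C f, bdd C f -> bdd (M * C) (B f) }.

Lemma opb_bounded_operator M B : opb M B -> bounded_operator B.
Proof.
move=> BM; split.
- by move=> k f g fb gb x; rewrite (opb_lin BM).
- by move=> f /bounded_bdd[C _ fC]; exact: bdd_bounded (opb_bdd BM fC).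
- exists M => f fb; have /andP[s0 _] := supnorm_le (normr_ge0 (supnorm f))
    (le_bdd (bdd_supnorm fb) (ler_norm _)).
  have Ms0 : 0 <= M * supnorm f by rewrite mulr_ge0// (opb_ge0 BM).
  by have /andP[] := supnorm_le Ms0 (opb_bdd BM (bdd_supnorm fb)).
Qed.

Lemma opnorm_le C B : 0 <= C -> (forall f, bdd 1 f -> bdd C (B f)) ->
  0 <= opnorm B <= C.
Proof.
move=> C0 BC; have ub : ubound [set supnorm (B f) | f in
    [set f | bounded_fun f /\ supnorm f <= 1]] C.
  move=> _ [f [fb f1] <-]; have /andP[//] := supnorm_le C0 (BC _ (le_bdd (bdd_supnorm fb) f1)).
(* [B] is not assumed linear here. The zero function only shows that the set of values is nonempty,
   and its value gives the lower bound 0. *)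
have b0 : bdd 0 (cst 0 : T -> R) by move=> x; rewrite normr0.
have mem0 : [set supnorm (B f) | f in
    [set f | bounded_fun f /\ supnorm f <= 1]] (supnorm (B (cst 0))).
  exists (cst 0) => //; split; first exact: bdd_bounded b0.
  by have /andP[_ h] := supnorm_le (lexx 0) b0; exact: le_trans h ler01.
apply/andP; split; last by apply: ge_sup; [exists (supnorm (B (cst 0)))|].
apply: (@le_trans _ _ (supnorm (B (cst 0)))); last by apply: ub_le_sup => //; exists C.
by have /andP[] := supnorm_le C0 (BC _ (le_bdd b0 ler01)).
Qed.

Lemma opb_id : opb 1 id.
Proof. by split=> // C f; rewrite mul1r. Qed.

Lemma opb_bounded M B f : opb M B -> bounded_fun f -> bounded_fun (B f).
Proof. by move=> BM /bounded_bdd[C _ fC]; exact: bdd_bounded (opb_bdd BM fC). Qed.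

Lemma opb_comp M N B B' : opb M B -> opb N B' -> opb (M * N) (fun f => B (B' f)).
Proof.
move=> BM BN; split.
- by rewrite mulr_ge0// (opb_ge0 BM, opb_ge0 BN).
- move=> k f g fb gb; rewrite (opb_lin BN)// (opb_lin BM)//; exact: opb_bounded BN _.
- by move=> C f /(opb_bdd BN)/(opb_bdd BM); rewrite mulrA.
Qed.

Lemma opb_iter M B n : opb M B -> opb (M ^+ n) (iter n B).
Proof.
move=> BM; elim: n => [|n IH]; first by rewrite expr0; exact: opb_id.
by rewrite exprS; exact: opb_comp BM IH.
Qed.

Lemma opb_comb (k : R) M N B B' : opb M B -> opb N B' ->
  opb (`|k| * M + N) (fun f x => k * B f x + B' f x).
Proof.
move=> BM BN; split.
- by rewrite addr_ge0// ?mulr_ge0// (opb_ge0 BM, opb_ge0 BN).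
- by move=> c f g fb gb; rewrite (opb_lin BN)// (opb_lin BM)//; apply/funext => x; ring.
- move=> C f fC; rewrite mulrDl -mulrA; apply: bdd_comb; [exact: (opb_bdd BM)|exact: (opb_bdd BN)].
Qed.

Lemma opb_euler (h : R) M B : opb M B -> opb (`|h| * M + 1) (fun g y => g y + h * B g y).
Proof.
move=> BM; have := opb_comb h BM opb_id; congr opb.
by apply/funext => g; apply/funext => y; rewrite addrC.
Qed.

Lemma opb_zero : opb 0 (fun _ _ => 0).
Proof.
split=> //; first by move=> k f g _ _; apply/funext => x; rewrite mulr0 addr0.
by move=> C f _ x; rewrite normr0 mul0r.
Qed.

Lemma le_opb M N B : opb M B -> M <= N -> opb N B.
Proof.
move=> BM MN; split; [exact: le_trans (opb_ge0 BM) MN|exact: (opb_lin BM)|].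
move=> C f fC x; rewrite (le_trans (opb_bdd BM fC x))// ler_wpM2r//.
exact: le_trans (normr_ge0 (f x)) (fC x).
Qed.

Lemma opb_expop_partial M B n : opb M B ->
  opb (series (exp_coeff M) n) (expop_partial B n).
Proof.
move=> BM; elim: n => [|n IH].
  rewrite /series/= big_geq//.
  rewrite (_ : expop_partial B 0 = fun _ _ => 0); first exact: opb_zero.
  by apply/funext => f; apply/funext => x; rewrite /expop_partial big_geq.
rewrite (_ : expop_partial B n.+1 =
    fun f x => (n`!%:R)^-1 * iter n B f x + expop_partial B n f x).
  have k0 : 0 <= n`!%:R^-1 :> R by rewrite invr_ge0.
  rewrite seriesS /exp_coeff/= mulrC -{1}[n`!%:R^-1]ger0_norm//.
  exact: opb_comb (opb_iter n BM) IH.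
apply/funext => f; apply/funext => x.
by rewrite /expop_partial big_nat_recr//= addrC.
Qed.

(** * Scalar estimates for the exponential *)

(** The inequality [1 + z <= expR z] at [z = - y], multiplied by [expR y], gives
    [expR y - 1 - y <= y (expR y - 1)]. The right side is at most [y^2 expR y] for [y >= 0] and at
    most [y^2] for [y < 0]. *)
Lemma expR_sub1D_le (y : R) : 0 <= expR y - 1 - y <= y ^+ 2 * expR `|y|.
Proof.
have h1 := expR_ge1Dx y; have h2 := expR_ge1Dx (- y).
have e0 := expR_gt0 y; have e1 : expR y * expR (- y) = 1 by rewrite expRN divff// gt_eqF.
apply/andP; split; first lra.
have [y0|y0] := leP 0 y.
  rewrite ger0_norm//.
  have h3 : expR y - 1 <= y * expR y by nra.
  nra.
have n0 : 1 <= expR `|y| by rewrite -expR0 ler_expR.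
have h3 : expR y - 1 <= y * expR y by nra.
nra.
Qed.


(** Induction on [q^(n+1) - p^(n+1) = q (q^n - p^n) + (q - p) p^n]. The assumption [1 <= q] permits
    the factor [q^n] instead of [q^(n-1)], which avoids a predecessor. *)
Lemma subXX_le (p q : R) n : 0 <= p <= q -> 1 <= q ->
  0 <= q ^+ n - p ^+ n <= n%:R * (q - p) * q ^+ n.
Proof.
move=> /andP[p0 pq] q1; elim: n => [|n /andP[IH0 IH1]].
  by rewrite !expr0 subrr mul0r mul0r lexx.
have pn0 : 0 <= p ^+ n by rewrite exprn_ge0.
have q0 : 0 <= q by lra.
have h1 : p ^+ n <= q * q ^+ n by nra.
have h2 : q * (q ^+ n - p ^+ n) <= q * (n%:R * (q - p) * q ^+ n) by rewrite ler_wpM2l.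
have h3 : (q - p) * p ^+ n <= (q - p) * (q * q ^+ n) by rewrite ler_wpM2l// subr_ge0.
have h4 : 0 <= (q - p) * p ^+ n by rewrite mulr_ge0// subr_ge0.
have h5 : 0 <= q * (q ^+ n - p ^+ n) by rewrite mulr_ge0.
rewrite !exprS -natr1; apply/andP; split; lra.
Qed.

(** With [x = a / (n+1)], [expR a] is the power [n+1] of [expR x]. The bases [1 + x] and [expR x]
    differ by at most [x^2 expR x], and [subXX_le] multiplies this by [n+1]. *)
Lemma expR_subXn_le (a : R) n : 0 <= a ->
  0 <= expR a - (1 + a / n.+1%:R) ^+ n.+1 <= a ^+ 2 * expR a ^+ 2 / n.+1%:R.
Proof.
move=> a0; set x := a / n.+1%:R.
have x0 : 0 <= x by rewrite divr_ge0.
have ea : expR a = expR x ^+ n.+1 by rewrite -expRM_natr /x divfK.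
have /andP[e0 e1] := expR_sub1D_le x.
have x1 : 1 <= expR x by rewrite -expR0 ler_expR.
have px : 0 <= 1 + x <= expR x by apply/andP; split; lra.
have /andP[] := subXX_le n.+1 px x1.
rewrite -ea => -> /= h; rewrite (le_trans h)//.
have ea0 : 0 <= expR a by rewrite ltW// expR_gt0.
rewrite (_ : a ^+ 2 * _ / _ = n.+1%:R * (x ^+ 2 * expR a) * expR a); last first.
  by rewrite /x; field.
rewrite ler_wpM2r//.
rewrite ler_wpM2l// opprD addrA (le_trans e1)// ler_wpM2l ?sqr_ge0//.
rewrite ler_expR ger0_norm// /x ler_pdivrMr// ler_peMr// ler1n//.
Qed.

(** * Convergence of the exponential series *)

Lemma expop_partialE B f x n :
  expop_partial B n f x = series (fun k => k`!%:R^-1 * iter k B f x) n.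
Proof. by []. Qed.

Lemma expop_partial_sub M B C f n m x : opb M B -> bdd C f -> (n <= m)%N ->
  `|expop_partial B m f x - expop_partial B n f x| <=
  C * (series (exp_coeff M) m - series (exp_coeff M) n).
Proof.
move=> BM fC nm; rewrite !expop_partialE !sub_series nm mulr_sumr.
rewrite (le_trans (ler_norm_sum _ _ _))//; apply: ler_sum => k _.
rewrite normrM ger0_norm ?invr_ge0// /exp_coeff/= mulrA mulrC ler_wpM2r ?invr_ge0//.
by rewrite mulrC; exact: (opb_bdd (opb_iter k BM)).
Qed.

Lemma series_exp_coeff_le M n : 0 <= M -> series (exp_coeff M) n <= expR M.
Proof.
move=> M0; apply: nondecreasing_cvgn_le; last exact: is_cvg_series_exp_coeff.
apply/nondecreasing_seqP => k; rewrite seriesSr lerDl; exact: exp_coeff_ge0.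
Qed.

Lemma expop_cvg M B C f x : opb M B -> bdd C f ->
  expop_partial B n f x @[n --> \oo] --> expop B f x.
Proof.
move=> BM fC; have M0 := opb_ge0 BM.
have C0 : 0 <= C by exact: le_trans (normr_ge0 (f x)) (fC x).
suff : cvgn (fun n => expop_partial B n f x) by [].
apply: normed_cvg.
apply: (@series_le_cvg _ _ (fun n => C * exp_coeff M n)) => [n|n|n|].
- by rewrite normr_ge0.
- by rewrite mulr_ge0// exp_coeff_ge0.
- rewrite /= normrM ger0_norm ?invr_ge0// /exp_coeff/= mulrA mulrC ler_wpM2r ?invr_ge0//.
  by rewrite mulrC; exact: (opb_bdd (opb_iter n BM)).
- exact: is_cvg_seriesZ (is_cvg_series_exp_coeff M).
Qed.

(** The limit [m -> oo] in [expop_partial_sub]. The bound is uniform in [x], hence controls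
    [opnorm]; at [n = 0] it bounds [expop] itself by [expR M]. *)
Lemma expop_tail M B C f n x : opb M B -> bdd C f ->
  `|expop_partial B n f x - expop B f x| <=
  C * (expR M - series (exp_coeff M) n).
Proof.
move=> BM fC; have C0 : 0 <= C by exact: le_trans (normr_ge0 (f x)) (fC x).
have /(cvgB (@cvg_cst _ (expop_partial B n f x) _ \oo _))/cvg_norm h := expop_cvg (x := x) BM fC.
apply: (cvgr_to_le h); exists n => // m /= nm.
rewrite distrC (le_trans (expop_partial_sub x BM fC nm))// ler_wpM2l//.
by rewrite lerB// series_exp_coeff_le// (opb_ge0 BM).
Qed.

Lemma opb_expop M B : opb M B -> opb (expR M) (expop B).
Proof.
move=> BM; split; first by rewrite ltW// expR_gt0.
- move=> k f g fb gb; apply/funext => x.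
  have [C _ fC] := bounded_bdd fb; have [D _ gD] := bounded_bdd gb.
  apply: cvg_lim => //.
  under eq_fun do rewrite (opb_lin (opb_expop_partial _ BM))//.
  by apply: cvgD; [apply: cvgMl_tmp|]; [exact: expop_cvg BM fC|exact: expop_cvg BM gD].
- move=> C f fC x; have := expop_tail 0 x BM fC.
  by rewrite /expop_partial /series/= !big_geq// sub0r normrN subr0 mulrC.
Qed.

Lemma expop_well_definedP M B : opb M B -> expop_well_defined B.
Proof.
move=> BM; split.
- by move=> n; exact: opb_bounded_operator (opb_expop_partial n BM).
- exact: opb_bounded_operator (opb_expop BM).
- have h n : 0 <= opnorm (fun f x => expop_partial B n f x - expop B f x) <=
      expR M - series (exp_coeff M) n.
    apply: opnorm_le; first by rewrite subr_ge0 series_exp_coeff_le// (opb_ge0 BM).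
    by move=> f f1 x; rewrite -[leRHS]mul1r; exact: expop_tail BM f1.
  apply: (squeeze_cvgr _ (@cvg_cst _ 0 _ \oo _)); first by apply: nearW => n; exact: h.
  rewrite -(subrr (expR M)); apply: cvgB; first exact: cvg_cst.
  exact: is_cvg_series_exp_coeff.
Qed.

(** * Euler products *)

(** The innermost factor is peeled off, with the induction hypothesis taken at a new [f]. Linearity
    of [iter k B] then splits each term in two, and Pascal's rule recombines them. *)
Lemma euler_binomial M B (h : R) n f x : opb M B -> bounded_fun f ->
  iter n (fun g y => g y + h * B g y) f x =
  \sum_(k < n.+1) 'C(n, k)%:R * h ^+ k * iter k B f x.
Proof.
move=> BM; elim: n f => [|n IH] f fb.
  by rewrite big_ord_recl big_ord0 /= bin0 expr0 !mul1r addr0.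
have -> : iter n.+1 (fun g y => g y + h * B g y) f x =
    iter n (fun g y => g y + h * B g y) (fun y => h * B f y + f y) x.
  by rewrite iterSr; congr (iter n _ _ x); apply/funext => y; rewrite addrC.
rewrite IH; last first.
  have [C _ fC] := bounded_bdd fb.
  exact: bdd_bounded (bdd_comb h (opb_bdd BM fC) fC).
have BE k : iter k B (fun y => h * B f y + f y) x = h * iter k.+1 B f x + iter k B f x.
  rewrite (opb_lin (opb_iter k BM))// ?iterSr//; exact: opb_bounded BM _.
under eq_bigr do rewrite BE mulrDr.
rewrite big_split/= [in RHS]big_ord_recl/= bin0 expr0.
under [in RHS]eq_bigr do rewrite /bump/= add1n binS natrD !mulrDl.
rewrite big_split/= [in RHS]big_ord_recr/= bin_small// !mul0r addr0.
rewrite [X in _ + X = _]big_ord_recl/= bin0 expr0 addrCA; congr (_ + _).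
by rewrite addrC; congr (_ + _); apply: eq_bigr => k _; rewrite /bump/= ?add1n// exprS; ring.
Qed.



Lemma le_harmonic_cvg0 (u : R ^nat) (K : R) : (forall n, `|u n| <= K * n.+1%:R^-1) ->
  u n @[n --> \oo] --> 0.
Proof.
move=> uK; apply/norm_cvg0P.
apply: (squeeze_cvgr _ (@cvg_cst _ 0 _ \oo _)).
  by apply: nearW => n; rewrite normr_ge0; exact: uK.
by rewrite -[X in _ --> X](mulr0 K); apply: cvgMl_tmp; exact: cvg_harmonic.
Qed.

(* The coefficient differences [1/k! - C(n,k)/n^k] are nonnegative, so the error is
   dominated by the scalar one [e^M - (1 + M/n)^n]. *)
Lemma euler_cvg M B C f x : opb M B -> bdd C f ->
  iter n.+1 (fun g y => g y + n.+1%:R^-1 * B g y) f x @[n --> \oo] --> expop B f x.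
Proof.
move=> BM fC; have M0 := opb_ge0 BM.
have C0 : 0 <= C by exact: le_trans (normr_ge0 (f x)) (fC x).
(* Cutting the series at [n.+2] leaves the degrees 0 to [n.+1], exactly those of the binomial
   expansion of the power [n.+1]. *)
have h n : `|expop_partial B n.+2 f x - iter n.+1 (fun g y => g y + n.+1%:R^-1 * B g y) f x|
    <= C * (M ^+ 2 * expR M ^+ 2) * n.+1%:R^-1.
  rewrite (euler_binomial _ _ _ BM (bdd_bounded fC)) /expop_partial big_mkord.
  rewrite -sumrB (le_trans (ler_norm_sum _ _ _))//.
  have binle (k : 'I_n.+2) : 0 <= k`!%:R^-1 - 'C(n.+1, k)%:R * n.+1%:R^-1 ^+ k :> R.
    rewrite subr_ge0 exprVn ler_pdivrMr ?exprn_gt0// mulrC ler_pdivlMr ?ltr0n ?fact_gt0//.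
    rewrite -natrM -natrX ler_nat bin_ffact.
    elim: {k}(k : nat) => [|k IH]; first by rewrite ffactn0.
    by rewrite ffactnSr expnSr leq_mul// leq_subr.
  rewrite (@le_trans _ _ (\sum_(k < n.+2)
      C * ((k`!%:R^-1 - 'C(n.+1, k)%:R * n.+1%:R^-1 ^+ k) * M ^+ k)))//.
    apply: ler_sum => k _; rewrite -mulrBl normrM ger0_norm//.
    rewrite mulrCA ler_wpM2l//; rewrite mulrC; exact: (opb_bdd (opb_iter k BM)).
  rewrite -mulr_sumr -mulrA ler_wpM2l//.
  have /andP[_] := expR_subXn_le n M0; apply: le_trans.
  under eq_bigr do rewrite mulrBl.
  rewrite sumrB lerB//.
    rewrite (le_trans _ (series_exp_coeff_le n.+2 M0))//.
    by rewrite /series/= big_mkord; apply: ler_sum => k _; rewrite /exp_coeff/= mulrC.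
  rewrite exprDn; apply: ler_sum => k _.
  by rewrite expr1n mul1r exprMn -mulr_natl mulrA [leRHS]mulrAC.
suff : expop_partial B n.+2 f x -
    (expop_partial B n.+2 f x - iter n.+1 (fun g y => g y + n.+1%:R^-1 * B g y) f x)
    @[n --> \oo] --> expop B f x - 0.
  by under eq_fun do rewrite opprB addrC subrK; rewrite subr0.
apply: cvgB.
  have -> : (fun n => expop_partial B n.+2 f x) = [sequence expop_partial B (n + 2)%N f x]_n.
    by apply/funext => n /=; rewrite addn2.
  by rewrite (@cvg_shiftn 2 _ (fun n => expop_partial B n f x)); exact: expop_cvg BM fC.
exact: le_harmonic_cvg0 h.
Qed.

(** Stability and consistency give convergence: [Q^(n+1) f - G^(n+1) f] is [Q] applied to the
    previous error plus [(Q - G) (G^n f)], a one-step error. As [1 <= q], the factor [q^n] of the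
    latter is absorbed into [q^(n+1)]. *)
Lemma iter_sub_bdd (q e : R) Q G n C f : opb q Q -> opb q G -> 1 <= q -> 0 <= e ->
  (forall D g, bdd D g -> bdd (e * D) (fun x => Q g x - G g x)) ->
  bdd C f -> bdd (n%:R * e * q ^+ n * C) (fun x => iter n Q f x - iter n G f x).
Proof.
move=> Qq Gq q1 e0 QG fC; elim: n => [|n IH] x.
  by rewrite /= subrr normr0 !mul0r.
have C0 : 0 <= C by exact: le_trans (normr_ge0 (f x)) (fC x).
have bQ := bdd_bounded (opb_bdd (opb_iter n Qq) fC).
have Gn := opb_bdd (opb_iter n Gq) fC.
have bG := bdd_bounded Gn.
have -> : iter n.+1 Q f x - iter n.+1 G f x =
    Q (fun y => iter n Q f y - iter n G f y) x + (Q (iter n G f) x - G (iter n G f) x).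
  rewrite (_ : (fun y => iter n Q f y - iter n G f y) =
      fun y => (-1) * iter n G f y + iter n Q f y); last by apply/funext => y; ring.
  by rewrite (opb_lin Qq)//=; ring.
rewrite (le_trans (ler_normD _ _))// (le_trans (lerD (opb_bdd Qq IH x) (QG _ _ Gn x)))//.
have qn : 0 <= q ^+ n by rewrite exprn_ge0//; lra.
rewrite exprS -natr1.
have h : 0 <= (q - 1) * (e * (q ^+ n * C)) by rewrite mulr_ge0 ?subr_ge0// !mulr_ge0.
lra.
Qed.
End Operators.

(** * Signed rates *)

Section Rates.
Variables (R : realType) (E : countType) (r : E -> E -> R) (V : E -> R).

Lemma ereal_sup_ub_real (I : Type) (u : I -> \bar R) : (forall i, 0 <= u i)%E ->
  (ereal_sup (range u) < +oo)%E -> exists2 C : R, 0 <= C & forall i, (u i <= C%:E)%E.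
Proof.
(* The absolute value gives a nonnegative constant without a case analysis on an empty [I], where
   the supremum is [-oo]. *)
move=> u0 us; exists `|fine (ereal_sup (range u))|; first exact: normr_ge0.
move=> i; have ui : (u i <= ereal_sup (range u))%E by apply: ereal_sup_ubound; exists i.
apply: (le_trans ui); rewrite -[leLHS]fineK; last first.
  by rewrite ge0_fin_numE// (le_trans (u0 i)).
by rewrite lee_fin ler_norm.
Qed.

Variables rho v : R.
Hypothesis rrho : forall x, absum rho (r x).
Hypothesis v0 : 0 <= v.
Hypothesis Vv : bdd v V.

Lemma absum_rplus x : absum rho (rplus r x).
Proof.
apply: absum_le (rrho x) => y; rewrite ger0_norm ?le_max ?lexx ?orbT//.
by rewrite ge_max normr_ge0 ler_norm.
Qed.

Lemma absum_rminus x : absum rho (rminus r x).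
Proof.
apply: absum_le (rrho x) => y; rewrite ger0_norm ?le_max ?lexx ?orbT//.
by rewrite ge_max normr_ge0 -normrN ler_norm.
Qed.

(** The map [w] sends the target of a jump to a state. Taking [id], [(y, s)] or [(y, ~~ s)] covers
    the sum in [signedA] and both sums in [Lhat]. *)
Lemma absum_diff (T : Type) (u : E -> R) (g : T -> R) (w : E -> T) C a : absum rho u -> bdd C g ->
  absum (rho * (2 * C)) (fun y => u y * (g (w y) - g a)).
Proof.
move=> ur gC; have C0 : 0 <= C by exact: le_trans (normr_ge0 (g a)) (gC a).
apply: absumM ur _ _; first by rewrite mulr_ge0.
move=> y; rewrite (le_trans (ler_normB _ _))//.
by have := gC (w y); have := gC a; lra.
Qed.

Lemma csum_diff_linear (T : Type) (u : E -> R) (f g : T -> R) (w : E -> T) k a :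
  absum rho u -> bounded_fun f -> bounded_fun g ->
  csum (fun y => u y * (k * f (w y) + g (w y) - (k * f a + g a))) =
  k * csum (fun y => u y * (f (w y) - f a)) + csum (fun y => u y * (g (w y) - g a)).
Proof.
move=> ur /bounded_bdd[C _ fC] /bounded_bdd[D _ gD].
rewrite -(csum_linear k (absum_diff w a ur fC) (absum_diff w a ur gD)).
by congr csum; apply/funext => y; ring.
Qed.

Lemma opb_signedA : 0 <= rho -> opb (2 * rho + v) (signedA r V).
Proof.
move=> rho0; split; first by rewrite addr_ge0// mulr_ge0.
- move=> k f g fb gb; apply/funext => x; rewrite /signedA.
  by rewrite (csum_diff_linear id k x (rrho x) fb gb); ring.
- move=> C f fC x; rewrite /signedA (le_trans (ler_normD _ _))//.
  have h := csum_norm (absum_diff id x (rrho x) fC).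
  have : `|V x * f x| <= v * C by rewrite normrM ler_pM.
  by move: h; lra.
Qed.

Lemma opb_Lhat : 0 <= rho -> opb (4 * rho) (Lhat r).
Proof.
move=> rho0; split; first by rewrite mulr_ge0.
- move=> k f g fb gb; apply/funext => a; rewrite /Lhat.
  have plus := csum_diff_linear (fun y => (y, a.2)) k a (absum_rplus a.1) fb gb.
  have minus := csum_diff_linear (fun y => (y, ~~ a.2)) k a (absum_rminus a.1) fb gb.
  by rewrite plus minus; ring.
- move=> C f fC a; rewrite /Lhat (le_trans (ler_normD _ _))//.
  have hp := csum_norm (absum_diff (fun y => (y, a.2)) a (absum_rplus a.1) fC).
  have hm := csum_norm (absum_diff (fun y => (y, ~~ a.2)) a (absum_rminus a.1) fC).
  by move: hp hm; lra.
Qed.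

Definition FKrate (x : E) : R := 2 * csum (fun y => rminus r x y) + V x.

Lemma FKrate_bdd : bdd (2 * rho + v) FKrate.
Proof.
move=> x; rewrite /FKrate (le_trans (ler_normD _ _))// lerD//.
by rewrite normrM ger0_norm// ler_wpM2l//; exact: csum_norm (absum_rminus x).
Qed.

Definition signed (f : E -> R) (a : E * bool) : R := (-1) ^+ a.2 * f a.1.

(* On functions [(x, s) |-> s * f x] the negative rates enter the generator as
   [- r^- (f y + f x)]; the potential [2 * sum r^-] turns this into [- r^- (f y - f x)]. *)
Lemma Lhat_signed f : bounded_fun f ->
  (fun a => Lhat r (signed f) a + FKrate a.1 * signed f a) = signed (signedA r V f).
Proof.
move=> /bounded_bdd[C _ fC]; have sC : bdd C (signed f).
  by move=> a; rewrite /signed normrM normrX normrN1 expr1n mul1r; exact: fC.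
apply/funext => -[x s]; rewrite /Lhat /FKrate /signedA/=.
have ap := absum_diff (fun y => (y, s)) (x, s) (absum_rplus x) sC.
have am := absum_diff (fun y => (y, ~~ s)) (x, s) (absum_rminus x) sC.
have ar := absum_diff id x (rrho x) fC.
set P := csum _; set N := csum _; set M := csum _.
rewrite /signed/=; set A := csum _.
(* The three sums are merged into one, so that the identity is checked for each [y] separately,
   where one of [rplus] and [rminus] vanishes. *)
have : 1 * P + ((2 * ((-1) ^+ s * f x)) * M + N) = (-1) ^+ s * A.
  rewrite /P /N /M /A -(csum_linear _ (absum_rminus x) am).
  rewrite -(csum_linear _ ap (absumD (absumZ _ (absum_rminus x)) am)).
  rewrite -(csumZ _ ar); congr csum; apply/funext => y.
  rewrite /signed/= signrN /rplus /rminus; have [r0|r0] := leP 0 (r x y).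
    by rewrite max_r ?oppr_le0//; ring.
  by rewrite max_l ?oppr_ge0 ?ltW//; ring.
lra.
Qed.
End Rates.

(** * Transition semigroups *)

Section Transition.
Variables (R : realType) (S : countType) (p : R -> S -> S -> R).
Hypothesis pt : transition_function p.

Lemma exchange_esum (I J : choiceType) (a : I -> J -> \bar R) :
  (forall i j, 0 <= a i j)%E ->
  (\esum_(i in [set: I]) \esum_(j in [set: J]) a i j =
   \esum_(j in [set: J]) \esum_(i in [set: I]) a i j)%E.
Proof.
move=> a0; rewrite !esum_esum//.
rewrite (reindex_esum (([set: J] `*`` (fun=> [set: I]))) _ (fun x => (x.2, x.1)))//.
split=> //=.
  by move=> [i1 i2] [j1 j2] /= _ _ [] -> ->.
by move=> [i1 i2] _ /=; exists (i2, i1).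
Qed.

Lemma absum_tf (t : R) a : 0 <= t -> absum 1 (p t a).
Proof.
move=> t0; rewrite /absum -(tf_sum1 pt a t0); apply: le_esum => b _.
by rewrite ger0_norm// (tf_ge0 pt).
Qed.

Lemma absum_tfM (t : R) a C g : 0 <= t -> bdd C g -> absum C (fun b => p t a b * g b).
Proof.
move=> t0 gC; rewrite -[C]mul1r; apply: absumM (absum_tf a t0) _ _ => //.
exact: le_trans (normr_ge0 (g a)) (gC a).
Qed.

Lemma opb_tf (t : R) : 0 <= t -> opb 1 (tf_op p t).
Proof.
move=> t0; split=> //.
- move=> k f g /bounded_bdd[C _ fC] /bounded_bdd[D _ gD]; apply/funext => a.
  rewrite /tf_op -(csum_linear k (absum_tfM a t0 fC) (absum_tfM a t0 gD)).
  by congr csum; apply/funext => b; ring.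
- by move=> C g gC a; rewrite mul1r; exact: csum_norm (absum_tfM a t0 gC).
Qed.

Lemma tf_op_EFin (t : R) a C g : 0 <= t -> (forall b, 0 <= g b) -> bdd C g ->
  ((tf_op p t g a)%:E = \esum_(b in [set: S]) (p t a b * g b)%:E)%E.
Proof.
move=> t0 g0 gC; apply: csum_EFin (absum_tfM a t0 gC) => b.
by rewrite mulr_ge0// (tf_ge0 pt).
Qed.

(* A bounded function is the difference of a nonnegative one and a constant. *)
Lemma ge0_linear_ext (B B' : (S -> R) -> S -> R) M M' : opb M B -> opb M' B' ->
  (forall g : S -> R, bounded_fun g -> (forall a, 0 <= g a) -> forall a, B g a = B' g a) ->
  forall g : S -> R, bounded_fun g -> forall a, B g a = B' g a.
Proof.
move=> BM BM' BB' g /bounded_bdd[C C0 gC] a.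
have cC : bdd C (cst C : S -> R) by move=> b; rewrite ger0_norm.
have gCb := bdd_comb 1 gC cC; have gb := bdd_bounded gCb; have cb := bdd_bounded cC.
have -> : g = fun b => (-1) * (cst C : S -> R) b + (1 * g b + cst C b).
  by apply/funext => b /=; ring.
rewrite (opb_lin BM)// (opb_lin BM')// !BB'// => b.
by rewrite mul1r; have := gC b; rewrite ler_norml => /andP[]; rewrite /cst; lra.
Qed.

(** Chapman-Kolmogorov summed against [g]. For [g >= 0] the double sum is exchanged in the extended
    reals; [ge0_linear_ext] then covers bounded [g]. *)
Lemma tf_op_comp (s t : R) g : 0 <= s -> 0 <= t -> bounded_fun g ->
  tf_op p s (tf_op p t g) = tf_op p (s + t) g.
Proof.
move=> s0 t0 gb; apply/funext; move: g gb.
apply: ge0_linear_ext (opb_comp (opb_tf s0) (opb_tf t0)) (opb_tf (addr_ge0 s0 t0)) _.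
move=> g /bounded_bdd[C C0 gC] g0 a; apply: EFin_inj.
have tg0 b : 0 <= tf_op p t g b.
  rewrite -lee_fin (tf_op_EFin _ t0 g0 gC) esum_ge0// => c _.
  by rewrite lee_fin mulr_ge0// (tf_ge0 pt).
rewrite (tf_op_EFin _ s0 tg0 (opb_bdd (opb_tf t0) gC)).
rewrite (tf_op_EFin _ (addr_ge0 s0 t0) g0 gC).
under eq_esum.
  move=> b _; rewrite EFinM (tf_op_EFin _ t0 g0 gC) -ge0_esumZ ?(tf_ge0 pt)//; last first.
    by move=> c; rewrite lee_fin mulr_ge0// (tf_ge0 pt).
  over.
rewrite exchange_esum; last first.
  by move=> b c; rewrite -EFinM lee_fin !mulr_ge0// (tf_ge0 pt).
apply: eq_esum => c _; rewrite EFinM (tf_CK pt)// (csum_EFin (B := 1)).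
- rewrite muleC -ge0_esumZ ?g0//; last first.
    by move=> b; rewrite lee_fin !mulr_ge0// (tf_ge0 pt).
  by apply: eq_esum => b _; rewrite -!EFinM; congr EFin; ring.
- by move=> b; rewrite mulr_ge0// (tf_ge0 pt).
(* Each [p t b c] is at most 1, being one term of a nonnegative family with sum 1. *)
- rewrite -[1]mul1r; apply: absumM (absum_tf a s0) _ _ => // b.
  rewrite ger0_norm ?(tf_ge0 pt)// -lee_fin -(tf_sum1 pt b t0).
  apply: esum_ge; exists [set c]; first by split.
  by rewrite fsbig_set1.
Qed.

Lemma tf_op0 g : bounded_fun g -> tf_op p 0 g = g.
Proof.
move=> gb; apply/funext; move: g gb.
apply: ge0_linear_ext (opb_tf (lexx 0)) (opb_id _ _) _.
move=> g /bounded_bdd[C C0 gC] g0 a; apply: EFin_inj.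
rewrite (tf_op_EFin _ (lexx 0) g0 gC) -[RHS](@esum_set1 _ _ a (fun b => (g b)%:E)); last first.
  by rewrite lee_fin.
rewrite [RHS]esum_mkcond; apply: eq_esum => b _; rewrite (tf_0 pt).
case: eqP => [->|ab]; first by rewrite mul1r mem_set.
by rewrite mul0r memNset// => /esym.
Qed.

(** * Small-time estimates from the generator *)

Variables (M : R) (L : (S -> R) -> S -> R).
Hypothesis LM : opb M L.
Hypothesis pL : has_generator p L.

(** Convergence to the generator multiplied by [h]: the first-order error is [o(h)], uniformly in
    the state. *)
Lemma generator_near g (e : R) : bounded_fun g -> 0 < e ->
  \forall h \near 0^'+, bdd (h * e) (fun a => tf_op p h g a - g a - h * L g a).
Proof.
move=> gb e0.
have unbhs : nbhs (L g : {uniform S -> R}) [set k | forall a, `|L g a - k a| < e].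
  apply/uniform_nbhs; exists [set xy | ball xy.1 e xy.2]; split.
    exact: (entourage_ball _ (PosNum e0)).
  by move=> k kE a; have := kE a I.
have pLe : \forall h \near 0^'+, forall a, `|L g a - h^-1 * (tf_op p h g a - g a)| < e.
  by have h := pL gb unbhs; rewrite /= in h; apply: h.
near=> h => a; have h0 : 0 < h by near: h; exact: nbhs_right_gt.
have : `|L g a - h^-1 * (tf_op p h g a - g a)| < e by move: a; near: h.
rewrite distrC => /ltW; rewrite -(ler_pM2l h0).
by rewrite -[X in X * `|_|]gtr0_norm// -normrM mulrBr mulrA divff ?gt_eqF// mul1r.
Unshelve. all: by end_near.
Qed.

(** The small step is an exact fraction of [s], so that [n.+1] of them telescope to [s]. *)
Lemma exists_small_step (P : R -> Prop) (s : R) : 0 < s -> (\forall h \near 0^'+, P h) ->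
  exists n, P (s / n.+1%:R).
Proof.
move=> s0 [d /= d0 dP]; exists (Num.truncn (s / d)).
have h0 : 0 < s / (Num.truncn (s / d)).+1%:R by rewrite divr_gt0.
apply: dP => //=; rewrite sub0r normrN gtr0_norm// ltr_pdivrMr// mulrC -ltr_pdivrMr//.
exact: truncnS_gt.
Qed.

(** The increment over [s] is a sum of increments over small steps [h], each transported by a
    contraction and at most [h (G + e / s)]. The tolerance [e / s] per unit of time adds up to [e],
    which is arbitrary. *)
Lemma tf_op_Lipschitz (s G : R) g : 0 <= s -> bounded_fun g -> bdd G (L g) ->
  bdd (s * G) (fun a => tf_op p s g a - g a).
Proof.
move=> s0 gb LG a; have [->|sn0] := eqVneq s 0.
  by rewrite tf_op0// subrr normr0 mul0r.
have {sn0}s0 : 0 < s by rewrite lt_neqAle eq_sym sn0.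
apply/ler_addgt0Pr => _/posnumP[e].
have es0 : 0 < e%:num / s by rewrite divr_gt0.
have [n] := exists_small_step s0 (generator_near gb es0).
set h := s / n.+1%:R => hP; have h0 : 0 < h by rewrite divr_gt0.
have step : bdd (h * (G + e%:num / s)) (fun a => tf_op p h g a - g a).
  move=> b; have -> : tf_op p h g b - g b = (tf_op p h g b - g b - h * L g b) + h * L g b by ring.
  rewrite (le_trans (ler_normD _ _))// mulrDr [leRHS]addrC lerD// normrM gtr0_norm//.
  by rewrite ler_wpM2l// ltW.
have main k : bdd (k%:R * (h * (G + e%:num / s))) (fun a => tf_op p (k%:R * h) g a - g a).
  elim: k => [|k IH] b; first by rewrite !mul0r tf_op0// subrr normr0.
  have kh0 : 0 <= k%:R * h by rewrite mulr_ge0// ltW.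
  rewrite -natr1 mulrDl mul1r [_ + h]addrC -tf_op_comp//; last exact: ltW.
  have Hh := opb_tf (ltW h0); have bk := opb_bounded (opb_tf kh0) gb.
  have -> : tf_op p h (tf_op p (k%:R * h) g) b - g b =
      tf_op p h (fun c => (-1) * g c + tf_op p (k%:R * h) g c) b + (tf_op p h g b - g b).
    by rewrite (opb_lin Hh)//; ring.
  rewrite (le_trans (ler_normD _ _))// mulrDl mul1r lerD//.
  have := opb_bdd Hh IH b; rewrite mul1r; congr (`|tf_op p h _ b| <= _).
  by apply/funext => c; ring.
have := main n.+1 a; rewrite mulrA /h.
have -> : n.+1%:R * (s / n.+1%:R) = s by field.
by rewrite mulrDr [s * (_ / s)]mulrCA divff ?gt_eqF// mulr1.
Qed.

(* Telescoping [s] into small steps avoids differentiating the semigroup: each step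
   costs [o(h)] by definition of the generator, plus [k h (P_h L g - L g) = O(k h^2)]. *)
Lemma tf_op_Taylor2 (s G : R) g : 0 <= s -> bounded_fun g -> bdd G (L (L g)) ->
  bdd (s ^+ 2 * G) (fun a => tf_op p s g a - g a - s * L g a).
Proof.
move=> s0 gb LG a; have [->|sn0] := eqVneq s 0.
  by rewrite tf_op0// subrr mul0r subrr expr0n mul0r normr0.
have {sn0}s0 : 0 < s by rewrite lt_neqAle eq_sym sn0.
have G0 : 0 <= G by exact: le_trans (normr_ge0 (L (L g) a)) (LG a).
have Lb := opb_bounded LM gb.
apply/ler_addgt0Pr => _/posnumP[e].
have es0 : 0 < e%:num / s by rewrite divr_gt0.
have [n] := exists_small_step s0 (generator_near gb es0).
set h := s / n.+1%:R => hP; have h0 : 0 < h by rewrite divr_gt0.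
pose D k b := tf_op p (k%:R * h) g b - g b - (k%:R * h) * L g b.
have main k : bdd (k%:R * h * (e%:num / s) + (k%:R * h) ^+ 2 * G) (D k).
  elim: k => [|k IH] b.
    by rewrite /D !mul0r tf_op0// subrr subr0 normr0 add0r expr0n mul0r.
  have kh0 : 0 <= k%:R * h by rewrite mulr_ge0// ltW.
  have Hh := opb_tf (ltW h0); have bk := opb_bounded (opb_tf kh0) gb.
  have -> : D k.+1 b = tf_op p h (D k) b + (tf_op p h g b - g b - h * L g b) +
      k%:R * h * (tf_op p h (L g) b - L g b).
    have -> : D k = fun c => (-1) * ((k%:R * h) * L g c + g c) + tf_op p (k%:R * h) g c.
      by apply/funext => c; rewrite /D; ring.
    have cb : bounded_fun (fun c => (k%:R * h) * L g c + g c).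
      have [C _ gC] := bounded_bdd gb; have [C' _ LC] := bounded_bdd Lb.
      exact: bdd_bounded (bdd_comb _ LC gC).
    rewrite (opb_lin Hh)// (opb_lin Hh)// tf_op_comp//; last exact: ltW.
    by rewrite /D -natr1 mulrDl mul1r [h + _]addrC; ring.
  rewrite (le_trans (ler_normD _ _))// (le_trans (lerD (ler_normD _ _) (lexx _)))//.
  have h1 := opb_bdd Hh IH b; rewrite mul1r in h1.
  have h2 := hP b.
  have h3 : `|k%:R * h * (tf_op p h (L g) b - L g b)| <= k%:R * h * (h * G).
    by rewrite normrM ger0_norm// ler_wpM2l//; exact: (tf_op_Lipschitz (ltW h0) Lb LG).
  have := lerD (lerD h1 h2) h3; move/le_trans; apply.
  (* The new error [k h^2 G] fits into [((k+1)^2 - k^2) h^2 G = (2k + 1) h^2 G]. *)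
  rewrite -natr1 mulrDl mul1r.
  have : 0 <= (k%:R * h) * (h * G) by rewrite !mulr_ge0// ltW.
  have : 0 <= h * (h * G) by rewrite !mulr_ge0// ltW.
  by lra.
have := main n.+1 a; rewrite /D /h.
have -> : n.+1%:R * (s / n.+1%:R) = s by field.
by rewrite [s * (_ / s)]mulrCA divff ?gt_eqF// mulr1 [leRHS]addrC.
Qed.


(** * Short time steps with a potential *)

Variables (W : S -> R) (w : R).
Hypothesis w0 : 0 <= w.
Hypothesis Ww : bdd w W.

(** The potential is read at the state reached after the step, which is what produces right Riemann
    sums along a path. *)
Definition weighted_step (h : R) (g : S -> R) : S -> R :=
  tf_op p h (fun b => expR (h * W b) * g b).

Lemma opb_mul (u : S -> R) C : 0 <= C -> bdd C u -> opb C (fun g b => u b * g b).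
Proof.
move=> C0 uC; split=> //.
- by move=> k f g _ _; apply/funext => b; ring.
- by move=> D g gD b; rewrite normrM ler_pM.
Qed.

Lemma expR_bdd (h : R) : 0 <= h -> bdd (expR (h * w)) (fun b => expR (h * W b)).
Proof.
move=> h0 b; rewrite gtr0_norm ?expR_gt0// ler_expR ler_wpM2l//.
exact: le_trans (ler_norm _) (Ww b).
Qed.

Lemma opb_weighted_step (h : R) : 0 <= h -> opb (expR (h * w)) (weighted_step h).
Proof.
move=> h0; rewrite -[expR _]mul1r.
exact: opb_comp (opb_tf h0) (opb_mul (ltW (expR_gt0 _)) (expR_bdd h0)).
Qed.

Lemma opb_generator_potential : opb (M + w) (fun g a => L g a + W a * g a).
Proof.
have := opb_comb 1 LM (opb_mul w0 Ww); rewrite normr1 mul1r.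
by congr opb; apply/funext => g; apply/funext => a; rewrite mul1r.
Qed.

(** The three terms of the constant are three second-order errors: [M^2] from the expansion of
    [tf_op p h g], [M w] from moving [W g] through the semigroup, and [w^2 expR (t w)] from
    linearizing the exponential weight. Using [t >= h] makes the constant independent of [h]. *)
Lemma weighted_step_err (t h C : R) g : 0 <= h <= t -> bdd C g ->
  bdd ((M ^+ 2 + M * w + w ^+ 2 * expR (t * w)) * h ^+ 2 * C)
    (fun a => weighted_step h g a - (g a + h * (L g a + W a * g a))).
Proof.
move=> /andP[h0 ht] gC a; have C0 : 0 <= C by exact: le_trans (normr_ge0 (g a)) (gC a).
have gb := bdd_bounded gC; have M0 := opb_ge0 LM.
pose e b := (expR (h * W b) - 1 - h * W b) * g b.
have eC : bdd (h ^+ 2 * (w ^+ 2 * expR (t * w)) * C) e.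
  move=> b; rewrite /e normrM ler_pM//.
  have /andP[e0 e1] := expR_sub1D_le (h * W b); rewrite ger0_norm// (le_trans e1)//.
  rewrite exprMn -mulrA ler_wpM2l ?sqr_ge0// ler_pM ?sqr_ge0 ?(ltW (expR_gt0 _))//.
    by rewrite -real_normK ?num_real// ler_pXn2r// ?nnegrE// normr_ge0.
  by rewrite ler_expR normrM (ger0_norm h0) ler_pM.
have WgC := opb_bdd (opb_mul w0 Ww) gC; have Wgb := bdd_bounded WgC.
have Hh := opb_tf h0.
have -> : weighted_step h g a - (g a + h * (L g a + W a * g a)) =
    (tf_op p h g a - g a - h * L g a) +
    h * (tf_op p h (fun b => W b * g b) a - W a * g a) + tf_op p h e a.
  have -> : weighted_step h g a = tf_op p h (fun b => h * (W b * g b) + (1 * g b + e b)) a.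
    by rewrite /weighted_step; congr (tf_op p h _ a); apply/funext => b; rewrite /e; ring.
  have gE := bdd_bounded (bdd_comb 1 gC eC); have eb := bdd_bounded eC.
  by rewrite (opb_lin Hh)// (opb_lin Hh)//; ring.
rewrite (le_trans (ler_normD _ _))// (le_trans (lerD (ler_normD _ _) (lexx _)))//.
have h1 := tf_op_Taylor2 h0 gb (opb_bdd LM (opb_bdd LM gC)) a.
have h2 := tf_op_Lipschitz h0 Wgb (opb_bdd LM WgC) a.
have h3 := opb_bdd Hh eC a; rewrite mul1r in h3.
have h4 : `|h * (tf_op p h (fun b => W b * g b) a - W a * g a)| <= h * (h * (M * (w * C))).
  by rewrite normrM ger0_norm// ler_wpM2l.
by have := lerD (lerD h1 h4) h3; move/le_trans; apply; lra.
Qed.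

(** Both steps are bounded by [expR (h (M + w))] and differ by [K h^2]. After [n+1] steps of length
    [h = t / (n+1)] the error is at most [K t^2 expR (t (M + w)) C / (n+1)]. *)
Lemma weighted_step_cvg (t : R) g a : 0 <= t -> bounded_fun g ->
  iter n.+1 (weighted_step (t / n.+1%:R)) g a -
  iter n.+1 (fun f b => f b + t / n.+1%:R * (L f b + W b * f b)) g a @[n --> \oo] --> 0.
Proof.
move=> t0 /bounded_bdd[C C0 gC]; have M0 := opb_ge0 LM.
set K := M ^+ 2 + M * w + w ^+ 2 * expR (t * w).
have K0 : 0 <= K.
  by rewrite !addr_ge0 ?sqr_ge0// ?mulr_ge0 ?sqr_ge0// ltW// expR_gt0.
apply: (@le_harmonic_cvg0 _ _ (K * t ^+ 2 * expR (t * (M + w)) * C)) => n.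
set h := t / n.+1%:R; have h0 : 0 <= h by rewrite divr_ge0.
have ht : h <= t by rewrite ler_pdivrMr// ler_peMr// ler1n.
have hMw : 0 <= h * (M + w) by rewrite mulr_ge0// addr_ge0.
have qQ : opb (expR (h * (M + w))) (weighted_step h).
  by apply: le_opb (opb_weighted_step h0) _; rewrite ler_expR ler_wpM2l// lerDr.
have qG : opb (expR (h * (M + w))) (fun f b => f b + h * (L f b + W b * f b)).
  apply: le_opb (opb_euler h opb_generator_potential) _.
  by rewrite ger0_norm// addrC expR_ge1Dx.
have q1 : 1 <= expR (h * (M + w)) by rewrite -expR0 ler_expR.
have e0 : 0 <= K * h ^+ 2 by rewrite mulr_ge0// sqr_ge0.
have err D f : bdd D f -> bdd (K * h ^+ 2 * D)
    (fun b => weighted_step h f b - (f b + h * (L f b + W b * f b))).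
  by move=> fD; apply: weighted_step_err fD; rewrite h0.
have := iter_sub_bdd n.+1 qQ qG q1 e0 err gC a; move/le_trans; apply.
rewrite -expRM_natr (_ : h * (M + w) * n.+1%:R = t * (M + w)); last by rewrite /h; field.
rewrite (_ : n.+1%:R * (K * h ^+ 2) = K * t ^+ 2 * n.+1%:R^-1); last by rewrite /h; field.
by rewrite le_eqVlt; apply/orP; left; apply/eqP; ring.
Qed.
End Transition.

(** * Discretized Feynman-Kac functionals *)

Section Process.
Variables (R : realType) (S : countType) (d : measure_display)
  (T : measurableType d) (P : probability T R).

(** Countable additivity over the values of [X], indexed by their [pickle] codes; integers that code
    no state give empty fibers and drop out of the sum. *)
Lemma ge0_integral_fibers (X : T -> S) (A : set T) (f : T -> \bar R) :
  (forall B : set S, measurable (X @^-1` B)) -> measurable A ->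
  measurable_fun setT f -> (forall x, 0 <= f x)%E ->
  (\int[P]_(x in A) f x =
   \esum_(b in [set: S]) \int[P]_(x in A `&` [set w | X w = b]) f x)%E.
Proof.
move=> mX mA mf f0; pose F n := A `&` X @^-1` [set b | pickle b = n].
have AF : A = \bigcup_n F n.
  apply/seteqP; split=> [x Ax|x [n _ []//]].
  by exists (pickle (X x)).
rewrite [in LHS]AF ge0_integral_bigcup//; last first.
- move=> m n _ _ [x [[_ /= <-] [_ /= <-]]] //.
- by apply: measurable_funTS.
- by move=> n; apply: measurableI.
rewrite nneseries_esumT; last by move=> n; exact: integral_ge0.
have -> : (\esum_(n in [set: nat]) \int[P]_(x in F n) f x =
    \esum_(n in range (@pickle S)) \int[P]_(x in F n) f x)%E.
  rewrite [RHS]esum_mkcond; apply: eq_esum => n _; case: ifPn => // /negP nr.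
  rewrite (_ : F n = set0) ?integral_set0//.
  apply/seteqP; split=> // x [_ /= xn]; apply: nr; rewrite inE.
  by exists (X x).
rewrite esum_image; last by move=> b c _ _; exact: (pcan_inj pickleK).
apply: eq_esum => b _; congr (integral _ _ _); rewrite /F; congr (_ `&` _).
by apply/seteqP; split=> x /= => [/(pcan_inj pickleK)|->].
Qed.

Implicit Types g : S -> R.

Variables (Y : R -> T -> S) (p : R -> S -> S -> R).
Hypothesis mY : forall t : R, 0 <= t -> forall B : set S, measurable (Y t @^-1` B).
Hypothesis pt : transition_function p.
Hypothesis markov : forall (h : seq (R * S)) (u t : R) (a b : S),
  (forall q : R * S, q \in h -> 0 <= q.1 <= u) -> 0 <= u -> 0 <= t ->
  (P (visits Y h `&` [set w | Y u w = a] `&` [set w | Y (u + t)%R w = b])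
   = P (visits Y h `&` [set w | Y u w = a]) * (p t a b)%:E)%E.

Lemma measurable_state (t : R) (phi : S -> R) : 0 <= t ->
  measurable_fun setT (fun w => phi (Y t w)).
Proof.
move=> t0 _ B mB; rewrite setTI.
exact: (mY t0 (phi @^-1` B)).
Qed.

Lemma visits_cons q h : visits Y (q :: h) = visits Y h `&` [set w | Y q.1 w = q.2].
Proof.
apply/seteqP; split=> w /=.
  by move=> H; split=> [c ch|]; apply: H; rewrite inE ?ch ?orbT ?eqxx.
by move=> [H Hq] c; rewrite inE => /predU1P[->|/H].
Qed.

Lemma measurable_visits h : (forall q : R * S, q \in h -> 0 <= q.1) ->
  measurable (visits Y h).
Proof.
elim: h => [|q h IH] h0.
  by rewrite (_ : visits Y [::] = setT)//; apply/seteqP; split.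
rewrite visits_cons; apply: measurableI.
  by apply: IH => c ch; apply: h0; rewrite inE ch orbT.
by apply: (mY (h0 q _) [set q.2]); rewrite inE eqxx.
Qed.

(** * Expectations of products along a sampled path *)

Variables (h : R) (phi : S -> R).
Hypothesis h0 : 0 <= h.
Hypothesis phi0 : forall a, 0 <= phi a.
Variable K : R.
Hypothesis phiK : bdd K phi.

(** The weights are collected at [u + h], ..., [u + n h], not at the initial time [u], and [g] is
    read at [u + n h]. *)
Fixpoint path_product n (u : R) (g : S -> R) (w : T) : R :=
  if n is n'.+1 then phi (Y (u + h) w) * path_product n' (u + h) g w else g (Y u w).

Lemma measurable_path_product n u g : 0 <= u -> measurable_fun setT (path_product n u g).
Proof.
elim: n u => [|n IH] u u0 /=; first exact: measurable_state.
by apply: measurable_funM; [apply: measurable_state|apply: IH]; rewrite addr_ge0.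
Qed.

Lemma path_product_ge0 n u g w : (forall a, 0 <= g a) -> 0 <= path_product n u g w.
Proof. by move=> g0; elim: n u => [|n IH] u //=; rewrite mulr_ge0. Qed.

Let step g := tf_op p h (fun b => phi b * g b).

Lemma opb_step : 0 <= K -> opb K step.
Proof.
move=> K0; rewrite -[K]mul1r.
exact: opb_comp (opb_tf pt h0) (opb_mul K0 phiK).
Qed.

(* The history is arbitrary so that conditioning on the state at [u + h] in the
   induction step just extends it by [(u, a)]. *)
Lemma path_product_integral n hist u a g : 0 <= K ->
  (forall q : R * S, q \in hist -> 0 <= q.1 <= u) -> 0 <= u ->
  (forall b, 0 <= g b) -> bounded_fun g ->
  (\int[P]_(w in visits Y hist `&` [set w | Y u w = a]) (path_product n u g w)%:E =
   P (visits Y hist `&` [set w | Y u w = a]) * (iter n step g a)%:E)%E.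
Proof.
move=> K0 + + g0 gb; have oS := opb_step K0.
have step0 m b : 0 <= iter m step g b.
  elim: m b => [|m IH] b //=; have [C _ gC] := bounded_bdd (opb_bounded (opb_iter m oS) gb).
  rewrite -lee_fin (tf_op_EFin pt _ h0 _ (opb_bdd (opb_mul K0 phiK) gC))//; last first.
    by move=> c; rewrite mulr_ge0.
  by rewrite esum_ge0// => c _; rewrite lee_fin !mulr_ge0// (tf_ge0 pt).
have mA hist' u' a' : (forall q : R * S, q \in hist' -> 0 <= q.1 <= u') -> 0 <= u' ->
    measurable (visits Y hist' `&` [set w | Y u' w = a']).
  move=> hu u0; apply: measurableI; last exact: (mY u0 [set a']).
  by apply: measurable_visits => q /hu /andP[].
elim: n hist u a => [|n IH] hist u a hu u0 /=.
  rewrite (@eq_integral _ _ _ _ _ (cst (g a)%:E)); last first.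
    by move=> w; rewrite inE => -[_ /= ->].
  by rewrite integral_cst; [rewrite muleC|exact: mA].
have uh0 : 0 <= u + h by rewrite addr_ge0.
have mF := measurable_path_product n g uh0.
(* The event is split by the state [b] at time [u + h]; on each piece the first weight is the
   constant [phi b]. *)
rewrite (ge0_integral_fibers (mY uh0) (mA _ _ _ hu u0)); last 2 first.
- apply/measurable_EFinP; apply: measurable_funM => //; exact: measurable_state.
- by move=> w; rewrite lee_fin mulr_ge0// path_product_ge0.
have huh q : q \in (u, a) :: hist -> 0 <= q.1 <= u + h.
  rewrite inE => /predU1P[->/=|/hu /andP[q0 qu]]; first by rewrite u0 lerDl.
  by rewrite q0 (le_trans qu)// lerDl.
have [C _ gC] := bounded_bdd (opb_bounded (opb_iter n oS) gb).
rewrite {2}/step (tf_op_EFin pt _ h0 _ (opb_bdd (opb_mul K0 phiK) gC)); last first.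
  by move=> c; rewrite mulr_ge0.
have PAE : P (visits Y hist `&` [set w | Y u w = a]) =
    (fine (P (visits Y hist `&` [set w | Y u w = a])))%:E.
  by rewrite fineK// fin_num_measure//; exact: mA.
rewrite PAE -ge0_esumZ ?fine_ge0//; last first.
  by move=> c; rewrite lee_fin !mulr_ge0// (tf_ge0 pt).
apply: eq_esum => b _; rewrite -PAE -(visits_cons (u, a)).
rewrite (@eq_integral _ _ _ _ _
    (fun w => (phi b)%:E * (path_product n (u + h) g w)%:E)%E); last first.
  by move=> w; rewrite inE => -[_ /= ->]; rewrite EFinM.
rewrite ge0_integralZl_EFin//; last 3 first.
- exact: mA huh uh0.
- by move=> w _; rewrite lee_fin path_product_ge0.
- by apply: measurable_funTS; exact/measurable_EFinP.
rewrite (IH _ _ _ huh uh0) visits_cons (markov _ _ hu u0 h0) muleCA !EFinM.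
by rewrite -!muleA; congr (_ * _)%E; rewrite muleCA.
Qed.

Variable a0 : S.
Hypothesis start : P [set w | Y 0 w = a0] = 1%E.

(** The initial state is only prescribed almost surely: the complement of the starting event is
    discarded as negligible, and the empty history applies on the rest. *)
Lemma ge0_expectation_path_product n g : 0 <= K -> (forall b, 0 <= g b) -> bounded_fun g ->
  (\int[P]_w (path_product n 0 g w)%:E = (iter n step g a0)%:E)%E.
Proof.
move=> K0 g0 gb; have mA : measurable [set w | Y 0 w = a0] := mY (lexx 0) [set a0].
rewrite (@ge0_negligible_integral _ _ _ _ _ (~` [set w | Y 0 w = a0])); last 5 first.
- exact: measurableC.
- by [].
- by apply/measurable_EFinP; exact: measurable_path_product.
- by move=> w _; rewrite lee_fin path_product_ge0.
- by rewrite [LHS](probability_setC P mA) start subee.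
have := @path_product_integral n [::] 0 a0 g K0 _ (lexx 0) g0 gb.
rewrite (_ : visits Y [::] = setT); last by apply/seteqP; split.
by rewrite setDE setCK !setTI start mul1e; exact.
Qed.

Lemma path_product_bdd n u C g w : 0 <= K -> bdd C g ->
  `|path_product n u g w| <= K ^+ n * C.
Proof.
move=> K0 gC; elim: n u => [|n IH] u /=; first by rewrite mul1r.
by rewrite normrM exprS -mulrA ler_pM.
Qed.

Lemma integrable_path_product n u g : 0 <= K -> 0 <= u -> bounded_fun g ->
  P.-integrable setT (EFin \o path_product n u g).
Proof.
move=> K0 u0 /bounded_bdd[C _ gC]; apply: measurable_bounded_integrable => //.
- by rewrite [X in (X < _)%E](probability_setT P) ltry.
- exact: measurable_path_product.
- have : bdd (K ^+ n * C) (path_product n u g) by move=> w; exact: path_product_bdd.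
  exact: bdd_bounded.
Qed.

Lemma path_productB n u f g w :
  path_product n u (fun b => f b - g b) w = path_product n u f w - path_product n u g w.
Proof. by elim: n u => [|n IH] u //=; rewrite IH mulrBr. Qed.

Lemma expectation_path_product n g : 0 <= K -> bounded_fun g ->
  (\int[P]_w (path_product n 0 g w)%:E = (iter n step g a0)%:E)%E.
Proof.
move=> K0 gb; have [C C0 gC] := bounded_bdd gb.
have cC : bdd C (cst C : S -> R) by move=> b; rewrite ger0_norm.
have gCb := bdd_bounded (bdd_comb 1 gC cC); have cb := bdd_bounded cC.
pose gp b := 1 * g b + (cst C : S -> R) b.
have gp0 b : 0 <= gp b.
  by rewrite /gp mul1r; have := gC b; rewrite ler_norml => /andP[]; rewrite /cst; lra.
(* Both [gp = g + C] and the constant [C] are nonnegative, and both sides are linear in [g]. *)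
have -> : g = fun b => gp b - C by apply/funext => b; rewrite /gp /cst; ring.
under eq_integral do rewrite path_productB EFinB.
rewrite integralB_EFin//; [|exact: integrable_path_product..].
rewrite !ge0_expectation_path_product// -EFinB; congr EFin.
rewrite (_ : (fun b => gp b - C) = fun b => (-1) * (cst C : S -> R) b + gp b).
  have -> : iter n step (fun b => (-1) * (cst C : S -> R) b + gp b) a0 =
      (-1) * iter n step (cst C) a0 + iter n step gp a0.
    by rewrite (opb_lin (opb_iter n (opb_step K0)) (-1) cb gCb).
  by rewrite mulN1r addrC.
by apply/funext => b; rewrite /cst; ring.
Qed.

End Process.

(** * Right Riemann sums along a right-continuous path *)

Section RiemannSum.
Variables (R : realType) (S : countType) (c : R -> S) (W : S -> R) (w : R).
Hypothesis Ww : bdd w W.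
Hypothesis cr : forall t : R, 0 <= t -> \forall s \near t^'+, c s = c t.

(* Right endpoints decrease to the current time as the mesh shrinks, so
   right-continuity alone gives convergence at every time. *)
Definition right_sum (t : R) n : R :=
  t / n.+1%:R * \sum_(k < n.+1) W (c (k.+1%:R * (t / n.+1%:R))).

Let step_fun (t : R) n (s : R) : R :=
  \sum_(k < n.+1) W (c (k.+1%:R * (t / n.+1%:R))) *
    \1_(`]k%:R * (t / n.+1%:R), k.+1%:R * (t / n.+1%:R)]%classic : set R) s.

(** The point [s'] is the first grid point at or after [s]; it exists because the last grid point is
    [t]. *)
Let step_funE (t : R) n (s : R) : s \in `]0, t] ->
  exists2 s', s <= s' < s + t / n.+1%:R & step_fun t n s = W (c s').
Proof.
rewrite in_itv/= => /andP[s0 st]; set h := t / n.+1%:R.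
have t0 : 0 < t by exact: lt_le_trans st.
have h0 : 0 < h by rewrite divr_gt0.
have ex : exists k, s <= k.+1%:R * h by exists n; rewrite /h mulrC divfK.
have lb : ex_minn ex = ex_minn ex by [].
case: {lb}(ex_minnP ex) => k sk kmin.
have ks : k%:R * h < s.
  case: k sk kmin => [|k] sk kmin; first by rewrite mul0r.
  by rewrite ltNge; apply/negP => /kmin; rewrite ltnn.
have kn : (k < n.+1)%N by rewrite ltnS; apply: kmin; rewrite /h mulrC divfK.
exists (k.+1%:R * h).
  by rewrite sk/= -natr1 mulrDl mul1r ltrD2r.
rewrite /step_fun (bigD1 (Ordinal kn))//= big1 ?addr0.
  by rewrite indicE mem_set ?mulr1//= in_itv/= ks sk.
move=> j jk; rewrite indicE memNset ?mulr0//= in_itv/= => /andP[js sj].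
have kj : (k <= j)%N := kmin _ sj.
have : (k < j)%N by rewrite ltn_neqAle kj andbT eq_sym.
move=> {}kj; have : k.+1%:R * h <= j%:R * h by rewrite ler_wpM2r ?ler_nat// ltW.
by rewrite leNgt (lt_le_trans js sk).
Qed.

Let measurable_step_fun (t : R) n : measurable_fun setT (step_fun t n).
Proof.
apply: measurable_sum => k; exact: measurable_funM.
Qed.

Let cvg_step_fun (t s : R) : s \in `]0, t] -> step_fun t n s @[n --> \oo] --> W (c s).
Proof.
move=> st; have /andP[s0 _] : 0 < s <= t by move: st; rewrite in_itv.
have [e /= e0 ce] := cr (ltW s0).
have t0 : 0 < t by move: st; rewrite in_itv/= => /andP[_]; exact: lt_le_trans.
(* The path is locally constant to the right of [s], so the sequence is eventually constant once the
   mesh is below [e]. *)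
apply: cvg_near_cst; near=> n.
have [s' /andP[ss' s's] ->] := step_funE n st.
have he : t / n.+1%:R < e.
  rewrite ltr_pdivrMr// mulrC -ltr_pdivrMr//.
  near: n; exists (Num.truncn (t / e)) => // n /= tn.
  by rewrite (lt_le_trans (truncnS_gt _))// ler_nat.
move: ss'; rewrite le_eqVlt => /predU1P[->//|ss'].
congr W; apply: ce => //=; rewrite ltr0_norm ?subr_lt0// opprB.
by rewrite ltrBlDl (lt_trans s's)// ltrD2l.
Unshelve. all: by end_near.
Qed.

Let step_fun_bdd (t : R) n s : 0 <= w -> s \in `]0, t] -> `|step_fun t n s| <= w.
Proof. by move=> w0 /(step_funE n)[s' _ ->]. Qed.

Let integral_step_fun (t : R) n : 0 < t ->
  (\int[lebesgue_measure]_(s in `]0%R, t]) (step_fun t n s)%:E = (right_sum t n)%:E)%E.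
Proof.
move=> t0; rewrite /step_fun; set h := t / n.+1%:R.
have h0 : 0 < h by rewrite divr_gt0.
under eq_integral do rewrite -sumEFin.
have mI (k : nat) : measurable (`]k%:R * h, k.+1%:R * h]%classic : set R) by [].
have fin : (lebesgue_measure (`]0%R, t]%classic : set R) < +oo)%E.
  by rewrite lebesgue_measure_itv/= lte_fin t0 -EFinB ltry.
have indI (k : nat) : integral lebesgue_measure `]0%R, t]
    (fun s => (\1_(`]k%:R * h, k.+1%:R * h]%classic : set R) s)%:E) =
    lebesgue_measure (`]k%:R * h, k.+1%:R * h]%classic `&` `]0%R, t]%classic : set R).
  by rewrite integral_indic.
have intI (k : nat) : lebesgue_measure.-integrable `]0%R, t]
    (fun s => (\1_(`]k%:R * h, k.+1%:R * h]%classic : set R) s)%:E).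
  apply: measurable_bounded_integrable => //.
  apply: (@bdd_bounded_on _ _ 1) => s; rewrite indicE.
  by case: (_ \in _); rewrite ?normr1 ?normr0.
rewrite integral_sum//; last first.
  by move=> k; under [X in integrable _ _ X]eq_fun do rewrite EFinM; exact: integrableZl.
rewrite /right_sum -/h mulr_sumr -sumEFin; apply: eq_bigr => k _.
under eq_integral do rewrite EFinM.
rewrite integralZl//.
rewrite indI setIidl; last first.
  move=> s /=; rewrite !in_itv/= => /andP[ks sk]; apply/andP; split.
    by rewrite (le_lt_trans _ ks)// mulr_ge0// ltW.
  rewrite (le_trans sk)// /h mulrCA -[leRHS]mulr1 ler_wpM2l ?(ltW t0)//.
  by rewrite ler_pdivrMr// mul1r ler_nat.
rewrite lebesgue_measure_itv/= lte_fin.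
have -> : k%:R * h < k.+1%:R * h by rewrite ltr_pM2r// ltr_nat.
by rewrite -EFinB -EFinM -mulrBl -natr1 [_ + 1]addrC addrK mul1r mulrC.
Qed.

Lemma right_sum_cvg (t : R) : 0 <= w -> 0 <= t ->
  right_sum t n @[n --> \oo] --> \int[lebesgue_measure]_(s in `[0, t]) W (c s).
Proof.
move=> w0 t0; have [->|tn0] := eqVneq t 0.
  rewrite set_itv1 /Rintegral integral_set1 /=.
  by under eq_fun do rewrite /right_sum mul0r mul0r; exact: cvg_cst.
have {tn0}t0 : 0 < t by rewrite lt_neqAle eq_sym tn0.
have mD : measurable (`]0, t]%classic : set R) by [].
have mf n : measurable_fun `]0, t] (EFin \o step_fun t n).
  by apply/measurable_EFinP; apply: measurable_funTS.
(* No measurability of the path in time is assumed; it is inherited from the step functions. *)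
have mW : measurable_fun `]0, t] (EFin \o (fun s => W (c s))).
  apply/measurable_EFinP; apply: (@measurable_fun_cvg _ _ _ _ (step_fun t)).
    by move=> n; apply: measurable_funTS.
  by move=> s st; exact: cvg_step_fun st.
have cvg_ae : {ae lebesgue_measure, forall s : R, (`]0, t]%classic : set R) s ->
    (EFin \o step_fun t n) s @[n --> \oo] --> (EFin \o (fun s => W (c s))) s}.
  by apply: aeW => s /= st; apply: cvg_EFin; [exact: nearW|exact: cvg_step_fun st].
have fin : (lebesgue_measure (`]0%R, t]%classic : set R) < +oo)%E.
  by rewrite lebesgue_measure_itv/= lte_fin t0 -EFinB ltry.
have int_cst : lebesgue_measure.-integrable `]0, t] (EFin \o (cst w : R -> R)).
  by apply: measurable_bounded_integrable => //; exact: bounded_cst.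
have le_ae : {ae lebesgue_measure, forall (s : R) n, (`]0, t]%classic : set R) s ->
    (`|(EFin \o step_fun t n) s| <= (EFin \o (cst w : R -> R)) s)%E}.
  by apply: aeW => s n /= st; rewrite lee_fin step_fun_bdd.
have [iW _] := @dominated_convergence _ (measurableTypeR R) R lebesgue_measure _ mD _ _
  (EFin \o (cst w : R -> R)) mf mW cvg_ae int_cst le_ae.
(* The step functions live on []0, t]]; the endpoint 0 is a null set. *)
rewrite -Rintegral_itv_obnd_cbnd//.
under [X in X @ _ --> _ -> _]eq_fun do rewrite integral_step_fun//.
have /fineK intE := @integrable_fin_num _ (measurableTypeR R) R lebesgue_measure _ mD _ iW.
by rewrite -intE => /fine_cvgP[_]; exact.
Qed.

End RiemannSum.

Lemma path_product_expR (R : realType) (S : countType) (d : measure_display)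
    (T : measurableType d) (Y : R -> T -> S)
    (h : R) (W : S -> R) n u g w :
  path_product Y h (fun b => expR (h * W b)) n u g w =
  expR (h * \sum_(k < n) W (Y (u + k.+1%:R * h) w)) * g (Y (u + n%:R * h) w).
Proof.
elim: n u => [|n IH] u /=.
  by rewrite big_ord0 mulr0 expR0 mul1r mul0r addr0.
have shift (k : nat) : u + h + k%:R * h = u + k.+1%:R * h.
  by rewrite -natr1 mulrDl mul1r -addrA [h + _]addrC.
rewrite IH big_ord_recl /= mul1r mulrDr expRD -mulrA shift.
by do 4!f_equal; apply: eq_bigr => k _; rewrite shift.
Qed.

(** * Feynman-Kac formula for signed rates *)

Section FeynmanKac.
Variables (R : realType) (E : countType) (r : E -> E -> R) (V : E -> R) (rho v : R).
Hypothesis rrho : forall x, absum rho (r x).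
Hypothesis rho0 : 0 <= rho.
Hypothesis v0 : 0 <= v.
Hypothesis Vv : bdd v V.

Lemma signed_false (f : E -> R) x : signed f (x, false) = f x.
Proof. by rewrite /signed expr0 mul1r. Qed.

Lemma iter_signed (h : R) n f : bounded_fun f ->
  iter n (fun g a => g a + h * (Lhat r g a + FKrate r V a.1 * g a)) (signed f) =
  signed (iter n (fun g y => g y + h * signedA r V g y) f).
Proof.
have oA := opb_signedA rrho v0 Vv rho0.
move=> fb; elim: n => [|n IH] //=; rewrite IH.
have fnb := opb_bounded (opb_iter n (opb_euler h oA)) fb.
set fn := iter n _ f in fnb *.
have := Lhat_signed V rrho fnb; move/(congr1 (fun g => g _)) => Ls.
by apply/funext => a; rewrite Ls /signed/=; ring.
Qed.

Lemma euler_semigroup_cvg (t : R) f x : 0 <= t -> bounded_fun f ->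
  iter n.+1 (fun g a => g a + t / n.+1%:R * (Lhat r g a + FKrate r V a.1 * g a))
    (signed f) (x, false) @[n --> \oo] --> semigroupS r V t f x.
Proof.
move=> t0 fb; have [C _ fC] := bounded_bdd fb.
have otA : opb (t * (2 * rho + v)) (fun g y => t * signedA r V g y).
  (* Scaling by [t] is a linear combination with the zero operator. *)
  have := opb_comb t (opb_signedA rrho v0 Vv rho0) (opb_zero _ _).
  rewrite ger0_norm// addr0; congr opb.
  by apply/funext => g; apply/funext => y; rewrite addr0.
under eq_fun do rewrite iter_signed// signed_false.
have := euler_cvg (x := x) otA fC.
rewrite /semigroupS; apply: cvg_trans; apply: near_eq_cvg; near=> n.
congr (iter _ _ _ _); apply/funext => g; apply/funext => y.
by rewrite mulrA [t / _]mulrC.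
Unshelve. all: by end_near.
Qed.

Variables (d : measure_display) (T : measurableType d) (P : probability T R)
  (Y : R -> T -> E * bool) (x : E).
Hypothesis jY : jump_process (Lhat r) (x, false) P Y.

(** The expectations of [X n] have two limits, which must agree: dominated convergence gives the
    expectation of [F], while as powers of [weighted_step] they approach Euler products tending to
    [semigroupS]. *)
Lemma signed_Feynman_Kac (f : E -> R) (t : R) : bounded_fun f -> 0 <= t ->
  ((semigroupS r V t f x)%:E =
   'E_P[(fun w => Zsign Y t w * f (Y t w).1 * FKweight r V Y t w)%R])%E.
Proof.
move=> fb t0; have [C C0 fC] := bounded_bdd fb.
have [mY cadY start [p [pt pL markov]]] := jY.
pose W (a : E * bool) := FKrate r V a.1; pose k := 2 * rho + v.
have k0 : 0 <= k by rewrite addr_ge0// mulr_ge0.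
have Wk : bdd k W by move=> a; exact: (FKrate_bdd rrho Vv).
have sC : bdd C (signed f).
  by move=> a; rewrite /signed normrM normrX normrN1 expr1n mul1r; exact: fC.
have sb := bdd_bounded sC.
pose h n : R := t / n.+1%:R.
have h0 n : 0 <= h n by rewrite divr_ge0.
have hn n : n.+1%:R * h n = t by rewrite /h; field.
(* There are [n.+1] steps of length [t / n.+1], so the last sampling time is exactly [t]. *)
pose X n w := path_product Y (h n) (fun b => expR (h n * W b)) n.+1 0 (signed f) w.
pose F w := Zsign Y t w * f (Y t w).1 * FKweight r V Y t w.
have XF w : X n w @[n --> \oo] --> F w.
  rewrite /F mulrC; under eq_fun do rewrite /X path_product_expR add0r hn.
  apply: cvgMr_tmp.
  have [cr _] := cadY w.
  have := cvg_comp _ _ (right_sum_cvg Wk cr k0 t0) (@continuous_expR R _).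
  apply: cvg_trans; apply: near_eq_cvg; near=> n.
  by rewrite /right_sum; under eq_bigr do rewrite add0r.
have mX n : measurable_fun setT (X n) by exact: measurable_path_product.
(* [F] contains a time integral of the path; its measurability is obtained from the limit of the
   discrete products. *)
have mF : measurable_fun setT F.
  by apply: (@measurable_fun_cvg _ _ _ _ X) => // w _; exact: XF.
have Xle n w : `|X n w| <= expR (t * k) * C.
  rewrite /X; have := path_product_bdd Y (h n) (expR_bdd Wk (h0 n)) n.+1 0 w (ltW (expR_gt0 _)) sC.
  by rewrite -expRM_natr mulrAC [h n * _]mulrC hn.
have intX n : (\int[P]_w (X n w)%:E)%E =
    (iter n.+1 (weighted_step p W (h n)) (signed f) (x, false))%:E.
  apply: (expectation_path_product mY pt markov (h0 n) _ (expR_bdd Wk (h0 n)) start) => //.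
have mEX n : measurable_fun setT (EFin \o X n) by exact/measurable_EFinP.
have mEF : measurable_fun setT (EFin \o F) by exact/measurable_EFinP.
have XF_ae : {ae P, forall w, [set: T] w -> (EFin \o X n) w @[n --> \oo] --> (EFin \o F) w}.
  by apply: aeW => w _; apply: cvg_EFin; [exact: nearW|exact: XF].
have int_cst := finite_measure_integrable_cst P (expR (t * k) * C) measurableT.
have le_ae : {ae P, forall w n, [set: T] w ->
    (`|(EFin \o X n) w| <= (EFin \o cst (expR (t * k) * C)%R) w)%E}.
  by apply: aeW => w n _; rewrite lee_fin.
have [_ _] := dominated_convergence measurableT mEX mEF XF_ae int_cst le_ae.
rewrite /=; under [X in X @ _ --> _ -> _]eq_fun do rewrite intX.
move=> cvgE; rewrite unlock; apply: (cvg_unique (@ereal_hausdorff R) _ cvgE).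
apply: cvg_EFin; first exact: nearW.
have step_cvg := weighted_step_cvg pt (opb_Lhat rrho rho0) pL k0 Wk (x, false) t0 sb.
rewrite -[semigroupS _ _ _ _ _]add0r.
apply: (cvg_trans _ (cvgD step_cvg (euler_semigroup_cvg (x := x) t0 fb))).
by apply: near_eq_cvg; near=> n; rewrite /= subrK.
Unshelve. all: by end_near.
Qed.

End FeynmanKac.

Theorem theorem2p1 (R : realType) (E : countType) (r : E -> E -> R) (V : E -> R)
    (r_diag : forall x, r x x = 0)
    (r_bdd : (ereal_sup (range (fun x : E => \esum_(y in [set: E]) `|r x y|%:E))
              < +oo)%E)
    (V_bdd : (ereal_sup (range (fun x : E => `|V x|%:E)) < +oo)%E) :
  [/\ bounded_operator (signedA r V),
      forall t : R, 0 <= t ->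
        expop_well_defined (fun (f : E -> R) (x : E) => t * signedA r V f x) &
      forall (f : E -> R) (x : E) (t : R), bounded_fun f -> 0 <= t ->
        forall (d : measure_display) (T : measurableType d) (P : probability T R)
          (Y : R -> T -> E * bool),
          jump_process (Lhat r) (x, false) P Y ->
          ((semigroupS r V t f x)%:E
           = 'E_P[(fun w => Zsign Y t w * f (Y t w).1 * FKweight r V Y t w)%R])%E].
Proof.
have r_ge0 x : (0 <= \esum_(y in [set: E]) `|r x y|%:E)%E.
  by apply: esum_ge0 => y _; rewrite lee_fin.
have V_ge0 x : (0 <= `|V x|%:E)%E by rewrite lee_fin.
have [rho rho0 rrho] := ereal_sup_ub_real r_ge0 r_bdd.
have [v v0 vV] := ereal_sup_ub_real V_ge0 V_bdd.
have Vv : bdd v V by move=> x; rewrite -lee_fin.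
have oA := opb_signedA rrho v0 Vv rho0; split.
- exact: opb_bounded_operator oA.
- move=> t _; have := opb_comb t oA (opb_zero _ _).
  move/expop_well_definedP; congr expop_well_defined.
  by apply/funext => f; apply/funext => x; rewrite addr0.
- by move=> f x t fb t0 d T P Y jY; exact: (signed_Feynman_Kac rrho rho0 v0 Vv jY fb t0).
Qed.
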